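(* The apex truncations of graphical zonotopes associated to oriented chains of complete bipartite graphs with at least $3$ parts, together with the simplicial basis, give an indecomposable polytopal basis for the deformation cone of the $2$-permutahedron. Precisely: let $n\ge1$ and let $\mathcal B^2_n$ be the $2$-braid fan in $\mathbb R^n$. Then $$\left\{\mathsf R(\mathcal S) : \mathcal S \text{ an ordered set partition of } [n] \text{ with at least three blocks}\right\}\cup\left\{\Delta_I : \emptyset\subsetneq I\subseteq[n]\right\}$$ is an indecomposable polytopal basis for $\operatorname{PL}(\mathcal B^2_n)$.
   Context: An ordered set partition of $[n]$ is a tuple $\mathcal S=(S_1,\dots,S_k)$ of pairwise disjoint nonempty subsets with union $[n]$. For $k\ge2$ define the zonotope (Minkowski sum of segments) $$\mathsf Z(\mathcal S)=\sum_{i=1}^{k-1}\ \sum_{a\in S_i,\,b\in S_{i+1}}[\mathbf 0,\,e_b-e_a]\subset\mathbb R^n,$$ i.e. the zonotope of the oriented graph on $[n]$ that is a chain of complete bipartite graphs between consecutive blocks. Its apex is the vertex $\mathbf 0$. The vector $u=\sum_{i=1}^k(i-1)\sum_{j\in S_i}e_j$ takes the value $1$ on each generator $e_b-e_a$ and is the canonical inner face normal of the face of the permutahedron indexed by $\mathcal S$. The apex truncation is $\mathsf R(\mathcal S)=\{x\in\mathsf Z(\mathcal S) : u\cdot x\ge1\}$. For $\emptyset\ne I\subseteq[n]$, $\Delta_I=\operatorname{conv}\{e_i:i\in I\}$; these polytopes are called the simplicial basis. $2$-braid fan. The braid fan $\mathcal B_n^1$ has cones $\operatorname{Cone}\{e_{T_1},\dots,e_{T_m}\}+\mathbb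 R e_{[n]}$ for flags $\emptyset\subsetneq T_1\subsetneq\dots\subsetneq T_m\subsetneq[n]$ (including the empty flag), where $e_T=\sum_{i\in T}e_i$. The $2$-braid fan $\mathcal B_n^2$ is its barycentric subdivision: to a nonempty flag $\mathcal F=(T_1\subsetneq\dots\subsetneq T_m)$ assign $u_{\mathcal F}=\sum_je_{T_j}$; the cones of $\mathcal B_n^2$ are $\operatorname{Cone}\{u_{\mathcal F_1},\dots,u_{\mathcal F_r}\}+\mathbb R e_{[n]}$ for chains $\mathcal F_1\subsetneq\dots\subsetneq\mathcal F_r$ of nonempty flags (ordered by inclusion, including the empty chain). A $2$-permutahedron is an $S_n$-invariant polytope with normal fan $\mathcal B_n^2$. Deformations. Support functions are $h(\mathsf Q,u)=\min_{x\in\mathsf Q}u\cdot x$, and normal fans are inner normal fans. $\operatorname{PL}(\Psi)$ is the vector space of functions on $\mathbb R^n$ linear on each cone of a complete fan $\Psi$; the deformation cone of $\Psi$ (or of a polytope with normal fan $\Psi$) consists of the support functions of polytopes whose normal fan coarsens $\Psi$ (each cone is a union of cones of $\Psi$). A polytopal basis is a collection of polytopes with normal fans coarsening $\Psi$ whose support functions form a basis of $\operatorname{PL}(\Psi)$. A deformation of $\mathsf P$ is a polytope whose normal fan coarsens that of $\mathsf P$; $\mathsf P$ is indecomposable if each of its deformations is a point or a translate of a positive dilate of $\mathsf P$. A polytopal basis is indecomposable if all its elements are. *)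

(* Defs.v *)
From mathcomp Require Import all_boot all_order all_algebra.
From mathcomp Require Import all_classical reals.

Set Implicit Arguments.
Unset Strict Implicit.
Unset Printing Implicit Defensive.

Import Order.TTheory GRing.Theory Num.Theory.
Local Open Scope classical_set_scope.
Local Open Scope ring_scope.

Definition dot (R : realType) (n : nat) (u x : 'rV[R]_n) : R :=
  \sum_(i < n) u 0 i * x 0 i.

Definition evec (R : realType) (n : nat) (i : 'I_n) : 'rV[R]_n := delta_mx 0 i.

Definition indic_vec (R : realType) (n : nat) (T : {set 'I_n}) : 'rV[R]_n :=
  \sum_(i in T) evec R i.

Definition conv (R : realType) (n : nat) (A : set 'rV[R]_n) : set 'rV[R]_n :=
  [set x | exists (k : nat) (p : 'I_k -> 'rV[R]_n) (c : 'I_k -> R),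
     [/\ forall i, A (p i), forall i, 0 <= c i, \sum_i c i = 1
       & x = \sum_i c i *: p i]].

(* Polytopes are nonempty by convention. *)
Definition polytope (R : realType) (n : nat) (Q : set 'rV[R]_n) : Prop :=
  exists A : set 'rV[R]_n, [/\ finite_set A, A !=set0 & Q = conv A].

(* On a polytope the infimum is attained, so this is [min_(x in Q) u . x]. *)
Definition support_fun (R : realType) (n : nat) (Q : set 'rV[R]_n)
    (u : 'rV[R]_n) : R :=
  inf [set dot u x | x in Q].

(* The face of Q on which the linear form [dot u] is minimal. *)
Definition face (R : realType) (n : nat) (Q : set 'rV[R]_n) (u : 'rV[R]_n) :
    set 'rV[R]_n :=
  [set x | Q x /\ forall y, Q y -> dot u x <= dot u y].

Definition normal_cone (R : realType) (n : nat) (Q F : set 'rV[R]_n) :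
    set 'rV[R]_n :=
  [set u | F `<=` face Q u].

(* Inner normal fan; a fan is represented by its collection of cones. *)
Definition normal_fan (R : realType) (n : nat) (Q : set 'rV[R]_n) :
    set (set 'rV[R]_n) :=
  [set normal_cone Q (face Q u) | u in setT].

Definition coarsens (R : realType) (n : nat) (Sigma Psi : set (set 'rV[R]_n)) :
    Prop :=
  forall C, Sigma C -> exists2 D, D `<=` Psi & C = \bigcup_(K in D) K.

Definition PL (R : realType) (n : nat) (Psi : set (set 'rV[R]_n)) :
    set ('rV[R]_n -> R) :=
  [set f | forall C, Psi C ->
     exists l : {scalar 'rV[R]_n}, forall x, C x -> f x = l x].

(* The family (f t), for t in D, is a basis of the space W of real functions. *)
Definition is_basis (R : realType) (V T : Type) (D : set T) (f : T -> V -> R)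
    (W : set (V -> R)) : Prop :=
  [/\ forall t, D t -> W (f t),
      forall (k : nat) (p : 'I_k -> T) (c : 'I_k -> R),
        injective p -> (forall i, D (p i)) ->
        (forall v, \sum_i c i * f (p i) v = 0) -> forall i, c i = 0
    & forall g, W g ->
        exists (k : nat) (p : 'I_k -> T) (c : 'I_k -> R),
          (forall i, D (p i)) /\ forall v, g v = \sum_i c i * f (p i) v].

Definition polytopal_basis (R : realType) (n : nat)
    (Psi BB : set (set 'rV[R]_n)) : Prop :=
  (forall Q, BB Q -> polytope Q /\ coarsens (normal_fan Q) Psi) /\
  is_basis BB (@support_fun R n) (PL Psi).

Definition deformation (R : realType) (n : nat) (P Q : set 'rV[R]_n) : Prop :=
  polytope Q /\ coarsens (normal_fan Q) (normal_fan P).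

Definition indecomposable (R : realType) (n : nat) (P : set 'rV[R]_n) : Prop :=
  forall Q, deformation P Q ->
    (exists v, Q = [set v]) \/
    (exists (t : R) (v : 'rV[R]_n), 0 < t /\ Q = [set v + t *: x | x in P]).

Definition indecomposable_polytopal_basis (R : realType) (n : nat)
    (Psi BB : set (set 'rV[R]_n)) : Prop :=
  polytopal_basis Psi BB /\ forall P, BB P -> indecomposable P.

(* A flag T_1 < ... < T_m of nonempty proper subsets is encoded by the set
   {T_1, ..., T_m}, so that inclusion of flags is inclusion of sets. *)
Definition is_flag (n : nat) (F : {set {set 'I_n}}) : bool :=
  [forall T in F, (T != finset.set0) && (T != finset.setT)] &&
  [forall T in F, forall T' in F, (T \subset T') || (T' \subset T)].

Definition is_flag_chain (n : nat) (C : {set {set {set 'I_n}}}) : bool :=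
  [forall F in C, (F != finset.set0) && is_flag F] &&
  [forall F in C, forall F' in C, (F \subset F') || (F' \subset F)].

Definition flag_vec (R : realType) (n : nat) (F : {set {set 'I_n}}) :
    'rV[R]_n :=
  \sum_(T in F) indic_vec R T.

(* Cone {u_F | F in C} + R e_[n] *)
Definition chain_cone (R : realType) (n : nat) (C : {set {set {set 'I_n}}}) :
    set 'rV[R]_n :=
  [set x | exists (c : {set {set 'I_n}} -> R) (t : R),
     (forall F, 0 <= c F) /\
     x = (\sum_(F in C) c F *: flag_vec R F) + t *: indic_vec R finset.setT].
Arguments chain_cone R {n} C.

Definition braid2_fan (R : realType) (n : nat) : set (set 'rV[R]_n) :=
  [set chain_cone R C | C in [set C : {set {set {set 'I_n}}} | is_flag_chain C]].
Arguments braid2_fan R n : clear implicits.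

Definition ordered_set_partition (n : nat) (S : seq {set 'I_n}) : bool :=
  [&& all (fun B => B != finset.set0) S,
      pairwise (fun A B => finset.setI A B == finset.set0) S
    & \big[@finset.setU _/finset.set0]_(B <- S) B == finset.setT].

Definition minkowski_sum (R : realType) (n : nat) (A B : set 'rV[R]_n) :
    set 'rV[R]_n :=
  [set x + y | x in A & y in B].

(* Blocks are numbered from 0: [nth finset.set0 S i] is S_(i+1). *)
Definition zonotope (R : realType) (n : nat) (S : seq {set 'I_n}) :
    set 'rV[R]_n :=
  \big[@minkowski_sum R n/[set 0]]_(i < (size S).-1)
  \big[@minkowski_sum R n/[set 0]]_(a in nth finset.set0 S i)
  \big[@minkowski_sum R n/[set 0]]_(b in nth finset.set0 S i.+1)
    conv [set 0; evec R b - evec R a].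
Arguments zonotope R {n} S.

Definition osp_vec (R : realType) (n : nat) (S : seq {set 'I_n}) : 'rV[R]_n :=
  \sum_(i < size S) i%:R *: indic_vec R (nth finset.set0 S i).

Definition apex_truncation (R : realType) (n : nat) (S : seq {set 'I_n}) :
    set 'rV[R]_n :=
  [set x | zonotope R S x /\ 1 <= dot (osp_vec R S) x].
Arguments apex_truncation R {n} S.

Definition simplex (R : realType) (n : nat) (I : {set 'I_n}) : set 'rV[R]_n :=
  conv [set evec R i | i in [set` I]].
Arguments simplex R {n} I.

(* Main.v *)
Require Import Defs.
From HB Require Import structures.
From mathcomp Require Import all_boot all_order all_algebra.
From mathcomp Require Import all_classical reals.
From mathcomp Require Import ring lra.

(** Write [E] for the edges [(a, b)] between consecutive blocks of [S]. The
    truncated zonotope is the image of the part of the unit cube where the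
    coordinate sum is at least 1, a polytope whose vertices are the nonzero 0/1
    points; hence its support function is
      [h(v) = sum_E min(0, v_b - v_a) + g_S(v)],
      [g_S(v) = max(0, min_E (v_b - v_a))]
    ([support_trunc_zonotope]). The first sum is a combination of support
    functions of simplices, as [min(v_a, v_b)] is that of [Delta_{a,b}].

    Basis. A function linear on the cones of the 2-braid fan is determined by its
    values at [e_[n]] and at the vectors [u_F] of flags, which are the vectors [u]
    of ordered set partitions. The function [g_S] vanishes on 0/1 vectors when [S]
    has at least three blocks; at the vector [u] of an ordered set partition [S']
    it is 1 if [S'] refines [S] and 0 otherwise, while the support function of
    [Delta_I] at [e_T] is 1 if [I] is contained in [T] and 0 otherwise. The
    matrix of values of the [g_S] and of the support functions of the simplices is
    therefore unitriangular, which gives independence and span ([basis_polytope_indep],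
    [basis_polytope_span]). That [g_S] is linear on each cone of the fan is
    [min_gap_chain_additive]. Every vector lies in the relative interior of such
    a cone ([chain_cone_cover], a layer-cake decomposition applied twice), so a
    polytope whose support function is linear on these cones has a normal fan
    that coarsens the 2-braid fan ([chain_additive_coarsens]).

    Indecomposability. The support function [f] of a deformation of [P] is
    additive on every pair of vectors on which that of [P] is
    ([deformation_additive]), and by Farkas' lemma it remains to write [f] as a
    linear form plus a multiple of the support function of [P]
    ([homothetic_support]). For the truncated zonotope, the second differences of
    [f] on indicator vectors vanish along pairs of indices not joined by an edge
    ([tame_exchange]). As the chain graph has no triangle, subtracting a linear
    form and multiples [tau_ab] of [min(v_a, v_b)] from [f] leaves a function that
    vanishes on all indicator vectors, hence wherever some slope [v_b - v_a] along
    an edge is nonpositive; it is then a multiple [s] of [g_S]. Additivity of [f]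
    across the apex cone gives [tau_ab = s] for every edge. *)

Set Implicit Arguments.
Unset Strict Implicit.
Unset Printing Implicit Defensive.

Import Order.TTheory GRing.Theory Num.Theory.
Local Open Scope classical_set_scope.
Local Open Scope ring_scope.

(** * Scalar products, convex hulls and support functions *)

Section Dot.
Context {R : realType} {n : nat}.
Implicit Types u v w x y : 'rV[R]_n.

Lemma dotC u x : dot u x = dot x u.
Proof. by apply: eq_bigr => i _; rewrite mulrC. Qed.

Lemma dotDl u v x : dot (u + v) x = dot u x + dot v x.
Proof. by rewrite -big_split; apply: eq_bigr => i _; rewrite mxE mulrDl. Qed.

Lemma dotZl t u x : dot (t *: u) x = t * dot u x.
Proof. by rewrite mulr_sumr; apply: eq_bigr => i _; rewrite mxE mulrA. Qed.

Lemma dotDr u x y : dot u (x + y) = dot u x + dot u y.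
Proof. by rewrite !(dotC u) dotDl. Qed.

Lemma dotZr t u x : dot u (t *: x) = t * dot u x.
Proof. by rewrite !(dotC u) dotZl. Qed.

Lemma dotNl u x : dot (- u) x = - dot u x.
Proof. by rewrite -scaleN1r dotZl mulN1r. Qed.

Lemma dotBr u x y : dot u (x - y) = dot u x - dot u y.
Proof. by rewrite dotDr -scaleN1r dotZr mulN1r. Qed.

Lemma dot0l x : dot 0 x = 0.
Proof. by rewrite -(scale0r 0) dotZl mul0r. Qed.

Lemma dot0r x : dot x 0 = 0.
Proof. by rewrite dotC dot0l. Qed.

Lemma dot_suml (I : Type) (r : seq I) (P : pred I) (F : I -> 'rV[R]_n) x :
  dot (\sum_(i <- r | P i) F i) x = \sum_(i <- r | P i) dot (F i) x.
Proof. by apply: (big_morph (fun u => dot u x)) => [u v|]; rewrite ?dotDl ?dot0l. Qed.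

Lemma dot_sumr (I : Type) (r : seq I) (P : pred I) (F : I -> 'rV[R]_n) x :
  dot x (\sum_(i <- r | P i) F i) = \sum_(i <- r | P i) dot x (F i).
Proof. by rewrite dotC dot_suml; apply: eq_bigr => i _; rewrite dotC. Qed.

Lemma evecE (i j : 'I_n) : evec R i 0 j = (j == i)%:R :> R.
Proof. by rewrite /evec mxE eqxx. Qed.

Lemma dot_evec u i : dot u (evec R i) = u 0 i.
Proof.
rewrite /dot (bigD1 i) //= evecE eqxx mulr1 big1 ?addr0 // => j ji.
by rewrite evecE (negbTE ji) mulr0.
Qed.

Lemma indic_vecE (T : {set 'I_n}) j : indic_vec R T 0 j = (j \in T)%:R.
Proof.
rewrite /indic_vec summxE.
under eq_bigr do rewrite evecE.
have [jT|jT] := boolP (j \in T).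
  rewrite (bigD1 j) //= eqxx big1 ?addr0 // => i /andP[_ /negbTE ij].
  by rewrite eq_sym ij.
rewrite big1 // => i iT; case: eqP => // ji.
by rewrite ji iT in jT.
Qed.

End Dot.

Section Convex.
Context {R : realType} {n : nat}.
Implicit Types (u v x y : 'rV[R]_n) (A Q : set 'rV[R]_n).

Lemma conv_sum A (I : finType) (P : {pred I}) (p : I -> 'rV[R]_n) (c : I -> R) :
  (forall i, i \in P -> A (p i)) -> (forall i, i \in P -> 0 <= c i) ->
  \sum_(i in P) c i = 1 -> conv A (\sum_(i in P) c i *: p i).
Proof.
move=> Ap c0 c1.
exists #|P|, (fun i => p (enum_val i)), (fun i => c (enum_val i)).
split; first by move=> i; apply: Ap; exact: enum_valP.
- by move=> i; apply: c0; exact: enum_valP.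
- by rewrite -c1 [RHS]big_enum_val.
- by rewrite [LHS]big_enum_val.
Qed.

Lemma sub_conv A : A `<=` conv A.
Proof.
move=> x Ax.
have -> : x = \sum_(i in [set: 'I_1]%SET) (1 : R) *: x.
  by rewrite (eq_bigl predT) ?big_ord1 ?scale1r // => i; rewrite !inE.
apply: conv_sum => //.
by rewrite (eq_bigl predT) ?big_ord1 // => i; rewrite !inE.
Qed.

Lemma conv_convex A x y (t : R) : conv A x -> conv A y -> 0 <= t -> t <= 1 ->
  conv A (t *: x + (1 - t) *: y).
Proof.
move=> [k [p [c [Ap c0 c1 ->]]]] [l [q [d [Aq d0 d1 ->]]]] t0 t1.
pose e (i : 'I_k + 'I_l) :=
  match i with inl i => t * c i | inr j => (1 - t) * d j end.
pose r (i : 'I_k + 'I_l) := match i with inl i => p i | inr j => q j end.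
have -> : t *: (\sum_i c i *: p i) + (1 - t) *: (\sum_i d i *: q i)
   = \sum_(i in predT) e i *: r i.
  rewrite big_sumType /= !scaler_sumr; congr (_ + _);
  by apply: eq_bigr => i _; rewrite scalerA.
apply: conv_sum.
- by case=> i _; [exact: Ap|exact: Aq].
- by case=> i _; rewrite mulr_ge0 ?subr_ge0.
- by rewrite big_sumType /= -!mulr_sumr c1 d1 !mulr1 addrC subrK.
Qed.

Lemma dot_conv_ge A u (m : R) : (forall a, A a -> m <= dot u a) ->
  forall x, conv A x -> m <= dot u x.
Proof.
move=> H x [k [p [c [Ap c0 c1 ->]]]].
rewrite dot_sumr -[m]mul1r -c1 mulr_suml; apply: ler_sum => i _.
by rewrite dotZr ler_wpM2l // H.
Qed.

Lemma support_funE Q u x : face Q u x -> support_fun Q u = dot u x.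
Proof.
move=> [Qx minx]; apply/eqP; rewrite eq_le; apply/andP; split.
- apply: ge_inf; last by exists x.
  by exists (dot u x) => _ [y Qy <-]; exact: minx.
- apply: lb_le_inf; first by exists (dot u x), x.
  by move=> _ [y Qy <-]; exact: minx.
Qed.

Lemma polytope_face Q u : polytope Q -> exists x, face Q u x.
Proof.
move=> [A [/finite_seqP[s ->] [a0 a0s] ->]].
have : exists2 a, a \in s & forall b, b \in s -> dot u a <= dot u b.
  elim: s a0 a0s => // b [|c s] IH a0 _.
    by exists b; rewrite ?inE // => z; rewrite inE => /eqP ->.
  have [|a ain amin] := IH c; first by rewrite /= !inE eqxx.
  have [le_ab|lt_ba] := leP (dot u a) (dot u b).
    exists a; first by rewrite inE ain orbT.
    by move=> z; rewrite inE => /orP[/eqP -> //|]; exact: amin.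
  exists b; first by rewrite inE eqxx.
  move=> z; rewrite inE => /orP[/eqP -> //|zs].
  by rewrite (le_trans (ltW lt_ba)) ?amin.
move=> [a ain amin]; exists a; split; first exact: sub_conv.
by apply: dot_conv_ge => b; exact: amin.
Qed.

Lemma support_fun_le Q u x : polytope Q -> Q x -> support_fun Q u <= dot u x.
Proof.
move=> PQ Qx; have [y [Qy miny]] := polytope_face u PQ.
by rewrite (@support_funE _ _ y) //; exact: miny.
Qed.

Lemma faceE Q u x : polytope Q ->
  face Q u x <-> Q x /\ dot u x = support_fun Q u.
Proof.
move=> PQ; split=> [fx|[Qx ux]].
  by split; [case: fx|rewrite (support_funE fx)].
by split=> // y Qy; rewrite ux support_fun_le.
Qed.

Lemma support_funZ Q u (t : R) : polytope Q -> 0 <= t ->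
  support_fun Q (t *: u) = t * support_fun Q u.
Proof.
move=> PQ t0; have [x fx] := polytope_face u PQ.
rewrite (support_funE fx) -dotZl; apply: support_funE.
by case: fx => Qx minx; split=> // y Qy; rewrite !dotZl ler_wpM2l ?minx.
Qed.

Lemma support_fun0 Q : polytope Q -> support_fun Q 0 = 0.
Proof. by move=> PQ; rewrite -(scale0r 0) support_funZ // mul0r. Qed.

Lemma support_funD_ge Q u w : polytope Q ->
  support_fun Q u + support_fun Q w <= support_fun Q (u + w).
Proof.
move=> PQ; have [x /faceE -/(_ PQ) [Qx <-]] := polytope_face (u + w) PQ.
by rewrite dotDl lerD ?support_fun_le.
Qed.

End Convex.

(** * Farkas' lemma and deformations *)

Section Farkas.
Context {R : realType}.

(** [b] is a combination of the vectors of [s] with nonnegative coefficients. *)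
Fixpoint in_cone m (s : seq 'rV[R]_m) (b : 'rV[R]_m) : Prop :=
  if s is a :: s' then exists t : R, 0 <= t /\ in_cone s' (b - t *: a)
  else b = 0.

Lemma in_cone_sum m (s : seq 'rV[R]_m) b : in_cone s b ->
  exists2 c : nat -> R, forall i, 0 <= c i &
    b = \sum_(i < size s) c i *: nth 0 s i.
Proof.
elim: s b => [b ->|a s IH b [t [t0 /IH[c c0 bE]]]] /=.
  by exists (fun=> 0) => //; rewrite big_ord0.
exists (fun i => if i is i'.+1 then c i' else t) => [[|i]//|].
by rewrite big_ord_recl /= -bE addrC subrK.
Qed.

(** Moving the generators along [a0] in the positive direction changes their
    cone only by multiples of [a0]. *)
Lemma in_cone_shear m (s : seq 'rV[R]_m) a0 (r : 'rV[R]_m -> R) b :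
  (forall a, a \in s -> 0 <= r a) ->
  in_cone [seq a + r a *: a0 | a <- s] b ->
  exists t, 0 <= t /\ in_cone s (b - t *: a0).
Proof.
elim: s b => [b _ ->|a s IH b r0 [t [t0 /IH]]] /=.
  by exists 0; split=> //; rewrite scale0r subr0.
case=> [c cs|t' [t'0 H]]; first by apply: r0; rewrite inE cs orbT.
exists (t * r a + t'); split.
  by rewrite addr_ge0 // mulr_ge0 // r0 // inE eqxx.
exists t; split=> //.
rewrite (_ : _ - _ = b - t *: (a + r a *: a0) - t' *: a0) //.
by apply/rowP => i; rewrite !mxE; ring.
Qed.

Lemma dot_self_gt0 m (b : 'rV[R]_m) : b != 0 -> 0 < dot b b.
Proof.
move=> b0; rewrite lt_def; apply/andP; split; last first.
  by apply: sumr_ge0 => i _; rewrite -expr2 sqr_ge0.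
apply: contra b0 => /eqP bb; apply/eqP/rowP => i; rewrite mxE.
have /psumr_eq0P : forall j : 'I_m, true -> 0 <= b 0 j * b 0 j.
  by move=> j _; rewrite -expr2 sqr_ge0.
by move=> /(_ bb) /(_ i erefl) /eqP; rewrite mulf_eq0 orbb => /eqP.
Qed.

(** Farkas' lemma, by induction on the number of generators: if the separating
    vector obtained from the tail is negative on the head [a0], shear the tail
    along [a0] into the hyperplane where that vector vanishes. *)
Lemma farkas m (s : seq 'rV[R]_m) b : in_cone s b \/
  exists y, (forall a, a \in s -> 0 <= dot y a) /\ dot y b < 0.
Proof.
elim: {s}(size s) {-2}s (erefl (size s)) b => [|k IH] [|a0 s] //= ss b.
  have [->|b0] := eqVneq b 0; first by left.
  right; exists (- b); split=> //.
  by rewrite dotNl oppr_lt0 dot_self_gt0.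
move: ss => [ss].
have [bs|[y [ys yb]]] := IH _ ss b.
  by left; exists 0; split=> //; rewrite scale0r subr0.
have [ya|ya] := leP 0 (dot y a0).
  right; exists y; split=> // a; rewrite inE => /orP[/eqP ->//|]; exact: ys.
pose r a := - (dot y a / dot y a0).
have r0 a : a \in s -> 0 <= r a.
  by move=> /ys ya'; rewrite oppr_ge0 mulr_ge0_le0 // invr_le0 ltW.
have [bs|[z [zs zb]]] := IH [seq a + r a *: a0 | a <- s]
    ltac:(by rewrite size_map) (b + r b *: a0).
  left; have [t [t0 bt]] := in_cone_shear r0 bs.
  exists (t - r b); split.
    by rewrite addr_ge0 // opprK mulr_le0 ?invr_le0 // ltW.
  rewrite (_ : _ - _ = b + r b *: a0 - t *: a0) //.
  by apply/rowP => i; rewrite !mxE; ring.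
right; exists (z - (dot z a0 / dot y a0) *: y).
have E a : dot (z - (dot z a0 / dot y a0) *: y) a = dot z (a + r a *: a0).
  rewrite dotDl dotNl dotZl dotDr dotZr /r.
  by field; rewrite lt_eqF.
split; last by rewrite E.
move=> a; rewrite inE => /orP[/eqP ->|as_]; rewrite E.
  by rewrite /r divff ?lt_eqF // scaleN1r subrr dot0r.
by apply: zs; exact: map_f.
Qed.

Variable n : nat.

Lemma dot_row_mx (y : 'rV[R]_(n + 1)) (a : 'rV[R]_n) :
  dot y (row_mx a (const_mx 1)) = dot (lsubmx y) a + y 0 (rshift n 0).
Proof.
rewrite /dot big_split_ord big_ord1 /= row_mxEr mxE mulr1; congr (_ + _).
by apply: eq_bigr => i _; rewrite row_mxEl !mxE.
Qed.

(** A polytope is the intersection of its supporting half-spaces. *)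
Lemma polytope_halfspaces (Q : set 'rV[R]_n) x : polytope Q ->
  (forall u, support_fun Q u <= dot u x) -> Q x.
Proof.
move=> PQ H; have [A [/finite_seqP[s As] _ QE]] := PQ.
have [|[y [ys yx]]] := farkas [seq row_mx a (const_mx 1) | a <- s]
   (row_mx x (const_mx 1) : 'rV[R]_(n + 1)).
  move=> /in_cone_sum[c c0]; rewrite size_map => E.
  have xE : x = \sum_(i < size s) c i *: nth 0 s i.
    apply/rowP => j; move: E => /rowP /(_ (lshift 1 j)).
    rewrite row_mxEl !summxE => ->; apply: eq_bigr => i _.
    by rewrite !mxE (nth_map 0) // row_mxEl.
  rewrite QE xE; exists (size s), (fun i => nth 0 s i), (fun i => c i).
  split=> // [i|]; first by rewrite As /= mem_nth.
  move: E => /rowP /(_ (rshift n 0)).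
  rewrite row_mxEr mxE !summxE => ->; apply: eq_bigr => i _.
  by rewrite !mxE (nth_map 0) // row_mxEr mxE mulr1.
have [z fz] := polytope_face (lsubmx y) PQ.
have := H (lsubmx y); rewrite (support_funE fz).
case: fz; rewrite {1}QE => Az _.
have /dot_conv_ge /(_ z Az) : forall a, A a -> - y 0 (rshift n 0) <= dot (lsubmx y) a.
  move=> a; rewrite As => /= as_.
  have := ys _ (map_f (fun a => row_mx a (const_mx 1)) as_).
  by rewrite dot_row_mx; lra.
by move: yx; rewrite dot_row_mx; lra.
Qed.

End Farkas.

Section Deformation.
Context {R : realType} {n : nat}.
Implicit Types (u v w x y : 'rV[R]_n) (P Q : set 'rV[R]_n).

(** If [h_P] is additive on a pair of vectors, these lie with their sum in one
    normal cone of [P], hence in one normal cone of the deformation [Q]. *)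
Lemma deformation_additive P Q u w : polytope P -> deformation P Q ->
  support_fun P (u + w) = support_fun P u + support_fun P w ->
  support_fun Q (u + w) = support_fun Q u + support_fun Q w.
Proof.
move=> PP [PQ coarse] hP.
have [|D DP NE] := coarse (normal_cone Q (face Q (u + w))).
  by exists (u + w).
have : normal_cone Q (face Q (u + w)) (u + w) by [].
rewrite NE => -[K DK]; have [u1 _ H] := DP _ DK; rewrite -H => Kuw.
have faceP : face P (u + w) `<=` face P u `&` face P w.
  move=> z /(faceE _ _ PP)[Pz]; rewrite hP dotDl => zE.
  have := support_fun_le u PP Pz; have := support_fun_le w PP Pz => uz wz.
  by split; apply/(faceE _ _ PP); split=> //; lra.
have N z : face P (u + w) `<=` face P z -> normal_cone Q (face Q (u + w)) z.
  by move=> sz; rewrite NE; exists K => //; rewrite -[K]H => y /Kuw /sz.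
have [y fy] := polytope_face (u + w) PQ.
have fu : face Q u y by apply: (N u) fy => z /faceP[].
have fw : face Q w y by apply: (N w) fy => z /faceP[].
by rewrite (support_funE fy) (support_funE fu) (support_funE fw) dotDl.
Qed.

(** If [h_Q] is [t] times [h_P] up to a linear form, then [Q] is a point or a
    translate of [t P]: this is seen on supporting half-spaces when [0 < t],
    while [t <= 0] forces the width of [Q] to vanish in every direction. *)
Lemma homothetic_support Q P (t : R) v : polytope P -> polytope Q ->
  (forall u, support_fun Q u = dot u v + t * support_fun P u) ->
  (exists v, Q = [set v]) \/
  (exists (t : R) v, 0 < t /\ Q = [set v + t *: x | x in P]).
Proof.
move=> PP PQ hQ.
have width0 X u : polytope X -> support_fun X u + support_fun X (- u) <= 0.
  move=> PX; rewrite -(support_fun0 PX) -(subrr u).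
  exact: support_funD_ge.
have [t0|t0] := ltP 0 t.
  right; exists t, v; split=> //; apply/seteqP; split=> [y Qy|_ [x Px <-]].
    exists (t^-1 *: (y - v)); last first.
      by rewrite scalerA divff ?gt_eqF // scale1r addrC subrK.
    apply: polytope_halfspaces => // u.
    rewrite dotZr dotBr ler_pdivlMl //.
    by have := support_fun_le u PQ Qy; rewrite hQ; lra.
  apply: polytope_halfspaces => // u.
  by rewrite hQ dotDr dotZr lerD2l ler_pM2l // support_fun_le.
have hN u : support_fun Q u + support_fun Q (- u) = 0.
  apply/eqP; rewrite eq_le width0 //= !hQ dotNl.
  have := width0 P u PP.
  rewrite (_ : _ + _ + _ = t * (support_fun P u + support_fun P (- u))).
    by move=> H; rewrite mulr_le0.
  by ring.
left; have [y [Qy _]] := polytope_face 0 PQ.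
exists y; apply/seteqP; split=> [z Qz|_ ->] //=.
have dz z' : Q z' -> forall u, dot u z' = support_fun Q u.
  move=> Qz' u; apply/eqP; rewrite eq_le support_fun_le // andbT.
  have := support_fun_le (- u) PQ Qz'; rewrite dotNl.
  by have := hN u; lra.
by apply/rowP => i; rewrite -!dot_evec ![dot _ (evec _ _)]dotC !dz.
Qed.

End Deformation.

(** * Layer-cake decompositions and the cones of the 2-braid fan *)

Section LayerCake.
Context {R : realType} {X : finType}.

(** Induction on nonnegative functions: peel off the least positive value along
    the support. *)
Lemma layer_ind (P : (X -> R) -> Prop) :
  P (fun=> 0) ->
  (forall (a : X -> R) (T : {set X}) (m : R), (forall x, 0 <= a x) -> 0 < m ->
     (forall x, a x != 0 -> x \in T) -> (exists2 x, x \in T & a x = 0) ->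
     P a -> P (fun x => a x + m * (x \in T)%:R)) ->
  forall a : X -> R, (forall x, 0 <= a x) -> P a.
Proof.
move=> P0 PS a; have [k] := ubnP #|[set x | a x != 0]%SET|.
elim: k a => // k IH a /ltnSE ak a0.
have [x0 ax0|az] := pickP (fun x => a x != 0); last first.
  rewrite (_ : a = fun=> 0) //; apply/funext => x.
  by have /negbFE/eqP := az x.
case: (arg_minP (P := fun x => a x != 0) a ax0) => x1 ax1 minx1.
set T : {set X} := [set x | a x != 0]%SET in ak.
have aE : a = fun x => (a x - a x1 * (x \in T)%:R) + a x1 * (x \in T)%:R.
  by apply/funext => x; rewrite subrK.
have b0 x : 0 <= a x - a x1 * (x \in T)%:R.
  rewrite inE; have [->|ax] := eqVneq (a x) 0; first by rewrite mulr0 subr0.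
  by rewrite mulr1 subr_ge0 minx1.
have bT x : a x - a x1 * (x \in T)%:R != 0 -> x \in T.
  by rewrite inE; have [->|//] := eqVneq (a x) 0; rewrite mulr0 subr0 eqxx.
have bx1 : a x1 - a x1 * (x1 \in T)%:R = 0 by rewrite inE ax1 mulr1 subrr.
rewrite aE; apply: (PS (fun x => a x - a x1 * (x \in T)%:R)) => //.
- by rewrite lt_def ax1 a0.
- by exists x1 => //; rewrite inE.
apply: IH => //; apply: leq_trans ak; apply: proper_card.
apply/fintype.properP; split; first by apply/fintype.subsetP => x; rewrite inE => /bT.
by exists x1; rewrite inE ?ax1 // bx1 eqxx.
Qed.

(** Layer-cake decomposition of a nonnegative function along a chain of nonempty
    sets contained in its support. *)
Lemma layer_cake (a : X -> R) : (forall x, 0 <= a x) ->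
  exists (C : {set {set X}}) (c : {set X} -> R),
    [/\ forall T, T \in C -> 0 < c T,
        forall T, T \in C -> T != finset.set0 /\ forall x, x \in T -> a x != 0,
        forall T T', T \in C -> T' \in C -> (T \subset T') || (T' \subset T)
      & forall x, a x = \sum_(T in C) c T * (x \in T)%:R].
Proof.
elim/layer_ind => {a} [|a T m a0 m0 aT [x0 x0T ax0] [C [c [c0 CT Cch aE]]]].
  exists finset.set0, (fun=> 0).
  by split=> [T|T|T T'|x]; rewrite ?inE // big_set0.
have TC T' : T' \in C -> T' \subset T /\ T' != T.
  move=> T'C; have [_ T'a] := CT _ T'C; split.
    by apply/fintype.subsetP => x /T'a /aT.
  by apply: contraTneq x0T => <-; apply/negP => /T'a; rewrite ax0 eqxx.
exists (T |: C), (fun T' => if T' == T then m else c T'); split.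
- by move=> T' /setU1P[->|T'C]; [rewrite eqxx|have [//|_] := eqVneq T' T; exact: c0].
- move=> T' T'C; have {}T'C : T' \subset T /\ T' != finset.set0.
    move/setU1P: T'C => [->|T'C]; last by have [? _] := TC _ T'C; have [? _] := CT _ T'C.
    by split=> //; apply/set0Pn; exists x0.
  case: T'C => /fintype.subsetP T'T T'0; split=> // x /T'T xT.
  by rewrite gt_eqF // xT mulr1 ltr_wpDl.
- move=> T1 T2 /setU1P[->|/[dup] T1C /TC[T1T _]] /setU1P[->|/[dup] T2C /TC[T2T _]];
  by rewrite ?subxx ?T1T ?T2T ?orbT // Cch.
move=> x; have TnC : T \notin C by apply/negP => /TC[_]; rewrite eqxx.
rewrite big_setU1 //= eqxx addrC aE; congr (_ + _).
by apply: eq_bigr => T' /TC[_ /negbTE ->].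
Qed.

End LayerCake.

Section ChainCones.
Context {R : realType} {n : nat}.
Implicit Types (u v w x y : 'rV[R]_n) (Q : set 'rV[R]_n).
Implicit Types (F : {set {set 'I_n}}) (C : {set {set {set 'I_n}}}).

Lemma flag_vecE F j : flag_vec R F 0 j = #|[set T in F | j \in T]%SET|%:R.
Proof.
rewrite /flag_vec summxE -sum1_card natr_sum big_mkcond [RHS]big_mkcond /=.
apply: eq_bigr => T _; rewrite inE indic_vecE.
by case: (T \in F); case: (j \in T).
Qed.

Lemma is_flagP F : reflect
  [/\ forall T, T \in F -> T != finset.set0, forall T, T \in F -> T != finset.setT
    & forall T T', T \in F -> T' \in F -> (T \subset T') || (T' \subset T)]
  (is_flag F).
Proof.
apply: (iffP andP) => [[/forall_inP H1 /forall_inP H2]|[H1 H2 H3]].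
  by split=> [T /H1/andP[]|T /H1/andP[]|T T' /H2/forall_inP]//; apply.
split; first by apply/forall_inP => T TF; rewrite H1 ?H2.
by apply/forall_inP => T TF; apply/forall_inP => T'; exact: H3.
Qed.

Lemma is_flag_chainP C : reflect
  [/\ forall F, F \in C -> F != finset.set0, forall F, F \in C -> is_flag F
    & forall F F', F \in C -> F' \in C -> (F \subset F') || (F' \subset F)]
  (is_flag_chain C).
Proof.
apply: (iffP andP) => [[/forall_inP H1 /forall_inP H2]|[H1 H2 H3]].
  by split=> [T /H1/andP[]|T /H1/andP[]|T T' /H2/forall_inP]//; apply.
split; first by apply/forall_inP => T TF; rewrite H1 ?H2.
by apply/forall_inP => T TF; apply/forall_inP => T'; exact: H3.
Qed.

(** Every vector lies in the relative interior of a cone of the 2-braid fan: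
    peel off superlevel sets of [v] minus its minimum, then superlevel sets of
    the coefficients obtained. *)
Lemma chain_cone_cover v : exists C (c : {set {set 'I_n}} -> R) (t : R),
  [/\ is_flag_chain C, forall F, F \in C -> 0 < c F &
     v = \sum_(F in C) c F *: flag_vec R F + t *: indic_vec R finset.setT].
Proof.
have [t [tv tmin]] : exists t : R, (forall i, t <= v 0 i) /\
    ((0 < n)%N -> exists i, v 0 i = t).
  have [i0 _|I0] := pickP 'I_n.
    case: (arg_minP (P := predT) (fun i => v 0 i) (erefl : predT i0)) => i _ mi.
    by exists (v 0 i); split=> [j|_]; [exact: mi|exists i].
  by exists 0; split=> [i|n0]; [have := I0 i|have := I0 (Ordinal n0)].
have [F0 [a [a0 F0T F0ch vE]]] := @layer_cake R _ (fun i => v 0 i - t)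
  (fun i => ltac:(by rewrite subr_ge0)).
pose b T := if T \in F0 then a T else 0.
have b0 T : 0 <= b T by rewrite /b; case: ifP => // /a0/ltW.
have [C [c [c0 CT Cch bE]]] := layer_cake b0.
have CF0 F : F \in C -> F \subset F0.
  move=> /CT[_ H]; apply/fintype.subsetP => T /H; rewrite /b.
  by case: ifP => //; rewrite eqxx.
exists C, c, t; split=> //.
  apply/is_flag_chainP; split=> [F /CT[]//|F /CF0 /fintype.subsetP FF0|//].
  apply/is_flagP; split=> [T /FF0 /F0T[]//|T|T T' /FF0 ? /FF0 ?]; last exact: F0ch.
  move=> /FF0 /F0T[/set0Pn[j jT] H]; apply/negP => /eqP TT.
  have [|i vi] := tmin; first by apply: leq_ltn_trans (ltn_ord j).
  by have := H i; rewrite TT inE vi subrr eqxx => /(_ erefl).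
apply/rowP => i; rewrite mxE summxE mxE indic_vecE inE mulr1.
apply/eqP; rewrite -subr_eq vE; apply/eqP.
transitivity (\sum_T b T * (i \in T)%:R).
  rewrite big_mkcond /=; apply: eq_bigr => T _; rewrite /b.
  by case: ifP; rewrite ?mul0r.
under eq_bigr do rewrite bE mulr_suml.
rewrite exchange_big /=; apply: eq_bigr => F _.
rewrite mxE flag_vecE -sum1_card natr_sum mulr_sumr [RHS]big_mkcond /=.
apply: eq_bigr => T _; rewrite inE -mulrA.
by case: (T \in F); case: (i \in T); rewrite /= ?mulr1 ?mulr0 ?mul0r ?mulr1.
Qed.

(** Linearity of [f] on the cones of the 2-braid fan, expressed on their
    generators. *)
Definition chain_additive (f : 'rV[R]_n -> R) : Prop :=
  forall C (c : {set {set 'I_n}} -> R) (t : R), is_flag_chain C ->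
    (forall F, 0 <= c F) ->
    f (\sum_(F in C) c F *: flag_vec R F + t *: indic_vec R finset.setT) =
    \sum_(F in C) c F * f (flag_vec R F) + t * f (indic_vec R finset.setT).

Lemma chain_cone_flag_vec C F : F \in C -> chain_cone R C (flag_vec R F).
Proof.
move=> FC; exists (fun F' => (F' == F)%:R), 0; split; first by move=> F'; case: eqP.
rewrite scale0r addr0 (bigD1 F) //= eqxx scale1r big1 ?addr0 // => F'.
by move=> /andP[_ /negbTE ->]; rewrite scale0r.
Qed.

Lemma chain_cone_all_ones C : chain_cone R C (indic_vec R finset.setT).
Proof.
exists (fun=> 0), 1; split=> //; rewrite scale1r big1 ?add0r // => F _.
by rewrite scale0r.
Qed.

Lemma PL_chain_additive f : PL (braid2_fan R n) f -> chain_additive f.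
Proof.
move=> plf C c t chC c0.
have [|l fl] := plf (chain_cone R C); first by exists C.
rewrite fl; last by exists c, t.
rewrite linearD linear_sum linearZ /= fl; last exact: chain_cone_all_ones.
congr (_ + _); apply: eq_bigr => F FC; rewrite linearZ /= fl //.
exact: chain_cone_flag_vec.
Qed.

(** A minimizer for one vector in the relative interior of a cone is a minimizer
    for the whole cone. *)
Lemma chain_additive_face Q C (c : {set {set 'I_n}} -> R) (t : R) y :
  polytope Q -> chain_additive (support_fun Q) -> is_flag_chain C ->
  (forall F, F \in C -> 0 < c F) ->
  face Q (\sum_(F in C) c F *: flag_vec R F + t *: indic_vec R finset.setT) y ->
  forall u, chain_cone R C u -> face Q u y.
Proof.
move=> PQ addQ chC c0; set w := _ + _ => /(faceE _ _ PQ)[Qy wy].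
pose c' F := if F \in C then c F else 0.
have c'0 F : 0 <= c' F by rewrite /c'; case: ifP => // /c0/ltW.
have wE : w = \sum_(F in C) c' F *: flag_vec R F + t *: indic_vec R finset.setT.
  by congr (_ + _); apply: eq_bigr => F FC; rewrite /c' FC.
have eE : support_fun Q (indic_vec R finset.setT) = dot (indic_vec R finset.setT) y.
  apply/eqP; rewrite eq_le support_fun_le //=.
  have := addQ C (fun=> 0) (-1) chC (fun=> lexx 0).
  rewrite !big1 ?add0r => [|F _|F _]; rewrite ?mul0r ?scale0r //.
  have := support_fun_le (-1 *: indic_vec R finset.setT) PQ Qy.
  by rewrite dotZl; lra.
have FE F : F \in C -> support_fun Q (flag_vec R F) = dot (flag_vec R F) y.
  move=> FC.
  have nn F' : F' \in C -> 0 <= c' F' * (dot (flag_vec R F') y - support_fun Q (flag_vec R F')).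
    by move=> _; rewrite mulr_ge0 // subr_ge0 support_fun_le.
  move: wy; rewrite wE addQ // dotDl dotZl -eE dot_suml => /addIr sE.
  have /psumr_eq0P : \sum_(F' in C)
      c' F' * (dot (flag_vec R F') y - support_fun Q (flag_vec R F')) = 0.
    under eq_bigr do rewrite mulrBr.
    rewrite sumrB -sE; apply/eqP; rewrite subr_eq0; apply/eqP.
    by apply: eq_bigr => F' _; rewrite dotZl.
  move=> /(_ nn F FC)/eqP; rewrite mulf_eq0 /c' FC gt_eqF ?c0 //= subr_eq0.
  by move=> /eqP.
move=> u [d [s [d0 ->]]]; apply/(faceE _ _ PQ); split=> //.
rewrite addQ // dotDl dotZl eE dot_suml; congr (_ + _).
by apply: eq_bigr => F FC; rewrite FE // dotZl.
Qed.

Let dotr y u := dot u y.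
Let dotr_is_scalar y : linear_for *%R (dotr y).
Proof. by move=> t u w; rewrite /dotr dotDl dotZl. Qed.
HB.instance Definition _ y := GRing.isLinear.Build R 'rV[R]_n R *%R (dotr y)
  (@dotr_is_scalar y).

Lemma chain_additive_PL Q : polytope Q -> chain_additive (support_fun Q) ->
  PL (braid2_fan R n) (support_fun Q).
Proof.
move=> PQ addQ _ [C chC <-].
have [y fy] := polytope_face (\sum_(F in C) (1 : R) *: flag_vec R F
  + 0 *: indic_vec R finset.setT) PQ.
exists (dotr y : {scalar _}) => u Cu; apply: support_funE.
by apply: (chain_additive_face PQ addQ chC _ fy Cu) => F _; exact: ltr01.
Qed.

Lemma chain_additive_coarsens Q : polytope Q -> chain_additive (support_fun Q) ->
  coarsens (normal_fan Q) (braid2_fan R n).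
Proof.
move=> PQ addQ _ [u0 _ <-]; set N := normal_cone _ _.
exists [set K | braid2_fan R n K /\ K `<=` N]; first by move=> K [].
apply/seteqP; split=> [w Nw|w [K [_ KN]]]; last exact: KN.
have [C [c [t [chC c0 wE]]]] := chain_cone_cover w.
exists (chain_cone R C); last first.
  exists (fun F => if F \in C then c F else 0), t; split.
    by move=> F; case: ifP => // /c0/ltW.
  by rewrite wE; congr (_ + _); apply: eq_bigr => F FC; rewrite FC.
split; first by exists C.
move=> u Cu y /Nw; rewrite wE => fy.
exact: (chain_additive_face PQ addQ chC c0 fy Cu).
Qed.

End ChainCones.

(** * Apex-truncated zonotopes and their support functions *)

Section TruncatedZonotope.
Context {R : realType} {n : nat}.
Implicit Types (u v w x y : 'rV[R]_n) (p q : 'I_n * 'I_n).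
Implicit Types (E A : {set 'I_n * 'I_n}).

(** The generator [e_b - e_a] attached to the edge [(a, b)]. *)
Definition edge_vec p : 'rV[R]_n := evec R p.2 - evec R p.1.

(** The slope [v_b - v_a] of [v] along the edge [(a, b)]. *)
Definition gap v p : R := v 0 p.2 - v 0 p.1.

Lemma dot_edge_vec v p : dot v (edge_vec p) = gap v p.
Proof. by rewrite dotBr !dot_evec. Qed.

Lemma gapD u v p : gap (u + v) p = gap u p + gap v p.
Proof. by rewrite /gap !mxE; ring. Qed.

Lemma gapZ t v p : gap (t *: v) p = t * gap v p.
Proof. by rewrite /gap !mxE; ring. Qed.

Lemma gap_all_ones p : gap (indic_vec R finset.setT) p = 0.
Proof. by rewrite /gap !indic_vecE !inE subrr. Qed.

(** The positive part of the least slope of [v] along the edges of [E]; it is 0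
    when [E] is empty. *)
Definition min_gap E v : R :=
  if [pick p in E] is Some p0
  then Num.max 0 (gap v [arg min_(p < p0 in E) gap v p]%O) else 0.

Lemma min_gapP E v : E != finset.set0 -> exists2 p, p \in E &
  min_gap E v = Num.max 0 (gap v p) /\ forall q, q \in E -> gap v p <= gap v q.
Proof.
move=> /set0Pn[p0 p0E]; rewrite /min_gap; case: pickP => [p1 p1E|/(_ p0)]; last by rewrite p0E.
by case: arg_minP => // p pE pmin; exists p.
Qed.

Lemma min_gap_ge0 E v : 0 <= min_gap E v.
Proof. by rewrite /min_gap; case: pickP => [p pE|//]; rewrite le_max lexx. Qed.

Lemma min_gap_eq E v p : p \in E -> (forall q, q \in E -> gap v p <= gap v q) ->
  min_gap E v = Num.max 0 (gap v p).
Proof.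
move=> pE pmin.
have [|q qE [-> qmin]] := @min_gapP E v; first by apply/set0Pn; exists p.
by congr Num.max; apply/eqP; rewrite eq_le qmin ?pmin.
Qed.

Lemma min_gap_eq0 E v p : p \in E -> gap v p <= 0 -> min_gap E v = 0.
Proof.
move=> pE vp; have [|q qE [-> qmin]] := @min_gapP E v.
  by apply/set0Pn; exists p.
by apply/max_idPl; apply: le_trans vp; exact: qmin.
Qed.

Lemma min_gap_le E v p : p \in E -> 0 <= gap v p -> min_gap E v <= gap v p.
Proof.
move=> pE vp; have [|q qE [-> qmin]] := @min_gapP E v.
  by apply/set0Pn; exists p.
by rewrite ge_max vp qmin.
Qed.

Lemma min_gap_gt0 E v p : 0 < min_gap E v -> p \in E -> 0 < gap v p.
Proof.
by move=> g0 pE; rewrite ltNge; apply: contraTN g0 => /(min_gap_eq0 pE) ->; rewrite ltxx.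
Qed.

(** The zonotope of [E] truncated at its apex 0, presented by the sums of the
    generators over nonempty subsets of [E]. *)
Definition trunc_zonotope E : set 'rV[R]_n :=
  conv [set \sum_(p in A) edge_vec p | A in
    [set A : {set 'I_n * 'I_n} | A != finset.set0 /\ A \subset E]].

Lemma polytope_trunc_zonotope E : E != finset.set0 -> polytope (trunc_zonotope E).
Proof.
move=> E0; exists [set \sum_(p in A) edge_vec p | A in
    [set A : {set 'I_n * 'I_n} | A != finset.set0 /\ A \subset E]].
split=> //; first by apply: finite_image; exact: finite_finset.
by exists (\sum_(p in E) edge_vec p), E.
Qed.

(** Points of the unit cube with coordinate sum at least 1 are convex
    combinations of nonzero 0/1 points; the number of fractional
    coordinates is lowered one at a time, until the sum is 1. *)
Lemma trunc_zonotopeI E (l : 'I_n * 'I_n -> R) :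
  (forall p, 0 <= l p <= 1) -> 1 <= \sum_(p in E) l p ->
  trunc_zonotope E (\sum_(p in E) l p *: edge_vec p).
Proof.
have base m : (forall p, 0 <= m p <= 1) -> \sum_(p in E) m p = 1 ->
    trunc_zonotope E (\sum_(p in E) m p *: edge_vec p).
  move=> m01 m1; apply: conv_sum => // p pE; last by case/andP: (m01 p).
  exists [set p]%SET; last by rewrite big_set1.
  by split; [apply/set0Pn; exists p; rewrite inE|rewrite finset.sub1set].
have [k] := ubnP #|[set p in E | (l p != 0) && (l p != 1)]%SET|.
elim: k l => // k IH l /ltnSE lk l01 l1.
have [sum1|sum1] := eqVneq (\sum_(p in E) l p) 1; first exact: base.
have {}l1 : 1 < \sum_(p in E) l p by rewrite lt_def sum1.
have [e /and3P[eE e0 e1]|noe] := pickP (fun p => [&& p \in E, l p != 0 & l p != 1]); last first.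
  have l01' p : p \in E -> l p = (l p == 1)%:R.
    move=> pE; have := noe p; rewrite pE /=.
    have [->|_ /=] := eqVneq (l p) 0; first by rewrite eq_sym oner_eq0.
    by move=> /negbFE/eqP ->; rewrite eqxx.
  apply: sub_conv; exists [set p in E | l p == 1]%SET.
    split; last by apply/fintype.subsetP => p; rewrite inE => /andP[].
    apply/eqP => E1; move: l1; rewrite big1 ?ltr10 // => p pE.
    rewrite l01' //; move/setP: E1 => /(_ p); rewrite !inE pE /= => ->.
    by [].
  rewrite big_mkcond [RHS]big_mkcond /=; apply: eq_bigr => p _; rewrite inE.
  have [pE|//] := boolP (p \in E).
  by rewrite [in RHS]l01' //; case: eqP => _; rewrite ?scale1r ?scale0r.
pose upd (z : R) p := if p == e then z else l p.
have sumupd z : \sum_(p in E) upd z p = \sum_(p in E) l p - l e + z.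
  rewrite (bigD1 e) //= [in RHS](bigD1 e) //= /upd eqxx.
  rewrite (eq_bigr l) => [|p /andP[_ /negbTE -> //]]; ring.
have updk z : z = 0 \/ z = 1 ->
    (#|[set p in E | ((upd z p != 0) && (upd z p != 1))%R]%SET| < k)%N.
  move=> z01; apply: leq_trans lk; apply: proper_card.
  apply/fintype.properP; split.
    apply/fintype.subsetP => p; rewrite !inE /upd; case: (p =P e) => // _.
    by case: z01 => ->; rewrite eqxx ?andbF.
  exists e; first by rewrite inE eE e0.
  by rewrite inE /upd eqxx; case: z01 => ->; rewrite eqxx ?andbF.
have /andP[le0 le1] := l01 e.
have upd01 z : 0 <= z <= 1 -> forall p, 0 <= upd z p <= 1.
  by move=> ? p; rewrite /upd; case: ifP.
have up : trunc_zonotope E (\sum_(p in E) upd 1 p *: edge_vec p).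
  apply: IH; [by apply: updk; right|by apply: upd01; rewrite ler01 lexx|].
  by rewrite sumupd; lra.
(* lower the fractional coordinate until it or the surplus vanishes *)
pose d := Num.max 0 (l e - (\sum_(p in E) l p - 1)).
have d0 : 0 <= d by rewrite le_max lexx.
have dl : d < l e.
  by rewrite gt_max lt_def e0 le0 /=; lra.
have dn : trunc_zonotope E (\sum_(p in E) upd d p *: edge_vec p).
  have d01 : 0 <= d <= 1 by rewrite d0 (le_trans (ltW dl)).
  have [dE|dE] := eqVneq d 0.
    apply: IH; [by apply: updk; left|by apply: upd01|].
    rewrite sumupd; have : l e - (\sum_(p in E) l p - 1) <= d by rewrite le_max lexx orbT.
    by lra.
  apply: base; first exact: upd01.
  rewrite sumupd; move: dE; rewrite /d; case: (leP 0 (l e - _)); last by rewrite eqxx.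
  by move=> _ _; ring.
have d1 : 1 - d != 0 by rewrite gt_eqF // subr_gt0 (lt_le_trans dl).
pose s := (l e - d) / (1 - d).
have -> : \sum_(p in E) l p *: edge_vec p =
    s *: (\sum_(p in E) upd 1 p *: edge_vec p) +
    (1 - s) *: (\sum_(p in E) upd d p *: edge_vec p).
  rewrite !scaler_sumr -big_split /=; apply: eq_bigr => p _.
  rewrite !scalerA -scalerDl; congr (_ *: _); rewrite /upd /s.
  by case: eqP => [->|_]; field.
apply: conv_convex => //.
  by rewrite divr_ge0 // subr_ge0 ?(ltW dl) // (le_trans (ltW dl)).
rewrite ler_pdivrMr ?mul1r ?lerD2r // subr_gt0.
by rewrite (lt_le_trans dl).
Qed.

(** Minimizing over the subsets of [E]: away from the cone where all slopes are
    positive one takes all edges of nonpositive slope, inside it a single edge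
    of least slope. *)
Lemma support_trunc_zonotope E v : E != finset.set0 ->
  support_fun (trunc_zonotope E) v =
  \sum_(p in E) Num.min 0 (gap v p) + min_gap E v.
Proof.
move=> E0.
have low A : A != finset.set0 -> A \subset E ->
    \sum_(p in E) Num.min 0 (gap v p) + min_gap E v <= \sum_(p in A) gap v p.
  move=> /set0Pn[p pA] /fintype.subsetP AE.
  have := min_gap_ge0 E v; rewrite le_eqVlt => /orP[/eqP<-|g0].
    rewrite addr0 big_mkcond [leRHS]big_mkcond /=; apply: ler_sum => q _.
    have [qA|qA] := boolP (q \in A); first by rewrite AE // ge_min lexx orbT.
    by case: ifP => _; rewrite // ge_min lexx.
  rewrite big1 ?add0r => [|q qE]; last first.
    by apply/min_idPl/ltW; exact: min_gap_gt0 g0 qE.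
  rewrite (bigD1 p) //= (le_trans (min_gap_le (AE _ pA) _)) //.
    by rewrite ltW // (min_gap_gt0 g0) // AE.
  rewrite lerDl sumr_ge0 // => q /andP[qA _].
  by rewrite ltW // (min_gap_gt0 g0) // AE.
have [A [A0 AE] hA] : exists2 A, A != finset.set0 /\ A \subset E &
    \sum_(p in A) gap v p = \sum_(p in E) Num.min 0 (gap v p) + min_gap E v.
  have [p pE [gE pmin]] := min_gapP v E0.
  have [vp|vp] := ltP 0 (gap v p).
    exists [set p]%SET.
      by split; [apply/set0Pn; exists p; rewrite inE|rewrite finset.sub1set].
    rewrite big_set1 gE big1 ?add0r => [|q qE]; first by apply/esym/max_idPr/ltW.
    by apply/min_idPl/ltW; apply: lt_le_trans vp _; exact: pmin.
  exists [set q in E | gap v q <= 0]%SET.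
    split; last by apply/fintype.subsetP => q; rewrite inE => /andP[].
    by apply/set0Pn; exists p; rewrite inE pE.
  rewrite (min_gap_eq0 pE vp) addr0 big_mkcond [RHS]big_mkcond /=.
  apply: eq_bigr => q _; rewrite inE; case: (q \in E) => //=.
  by case: (leP 0 (gap v q)) => [q0|/ltW -> //]; case: leP => // ?; lra.
rewrite -hA -(eq_bigr _ (fun p _ => dot_edge_vec v p)) -dot_sumr.
apply: support_funE; split; first by apply: sub_conv; exists A.
apply: dot_conv_ge => _ [B [B0 BE] <-].
rewrite !dot_sumr; under eq_bigr do rewrite dot_edge_vec.
by under [leRHS]eq_bigr do rewrite dot_edge_vec; rewrite hA low.
Qed.

End TruncatedZonotope.

(** * Ordered set partitions as level functions *)

Section Minkowski.
Context {R : realType} {n : nat}.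
Implicit Types (A B D : set 'rV[R]_n).

Let minkowskiA : associative (@minkowski_sum R n).
Proof.
move=> A B D; apply/seteqP; split=> x /=.
  move=> [a Aa [_ [b Bb [d Dd <-]] <-]]; exists (a + b); first by exists a => //; exists b.
  by exists d; rewrite ?addrA.
move=> [_ [a Aa [b Bb <-]] [d Dd <-]]; exists a => //.
by exists (b + d); [exists b => //; exists d|rewrite addrA].
Qed.

Let minkowskiC : commutative (@minkowski_sum R n).
Proof.
by move=> A B; apply/seteqP; split=> _ [a Aa [b Bb <-]]; exists b => //; exists a;
  rewrite // addrC.
Qed.

Let minkowski0 : left_id [set 0] (@minkowski_sum R n).
Proof.
move=> A; apply/seteqP; split=> [_ [_ -> [a Aa <-]]|a Aa]; first by rewrite add0r.
by exists 0 => //; exists a; rewrite ?add0r.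
Qed.

HB.instance Definition _ := Monoid.isComLaw.Build (set 'rV[R]_n) [set 0]
  (@minkowski_sum R n) minkowskiA minkowskiC minkowski0.

Lemma big_minkowskiP (I : finType) (P : pred I) (A : I -> set 'rV[R]_n) x :
  (\big[@minkowski_sum R n/[set 0]]_(i | P i) A i) x <->
  exists2 y : I -> 'rV[R]_n, forall i, P i -> A i (y i) & x = \sum_(i | P i) y i.
Proof.
suff main (s : seq I) : uniq s ->
    (\big[@minkowski_sum R n/[set 0]]_(i <- s) A i) x <->
    exists2 y : I -> 'rV[R]_n, forall i, i \in s -> A i (y i) & x = \sum_(i <- s) y i.
  have Pm i : (i \in [seq i <- index_enum I | P i]) = P i.
    by rewrite mem_filter mem_index_enum andbT.
  rewrite -big_filter main ?filter_uniq ?index_enum_uniq //.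
  by split=> -[y Ay ->]; exists y; rewrite ?big_filter // => i;
    [rewrite -Pm|rewrite Pm]; exact: Ay.
elim: s x => [x _|i s IH x /= /andP[is_ us]].
  rewrite big_nil; split=> [->|[y _ ->]]; last by rewrite big_nil.
  by exists (fun=> 0); rewrite ?big_nil.
rewrite big_cons; split.
  move=> [a Aa [_ /IH-/(_ us)[y Ay ->] <-]].
  exists (fun j => if j == i then a else y j).
    move=> j; rewrite inE; case: eqP => [->//|_]; exact: Ay.
  rewrite big_cons eqxx; congr (_ + _); rewrite !big_seq; apply: eq_bigr => j js.
  by case: eqP is_ => // <-; rewrite js.
move=> [y Ay ->]; rewrite big_cons; exists (y i); first by apply: Ay; rewrite inE eqxx.
exists (\sum_(j <- s) y j) => //; apply/(IH _ us); exists y => // j js.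
by apply: Ay; rewrite inE js orbT.
Qed.

Lemma conv_segmentP (g x : 'rV[R]_n) :
  conv [set 0; g] x <-> exists2 l : R, 0 <= l <= 1 & x = l *: g.
Proof.
split=> [[k [p [c [pg c0 c1 ->]]]]|[l /andP[l0 l1] ->]].
  exists (\sum_(i | p i == g) c i).
    rewrite sumr_ge0 //= -c1 [leLHS]big_mkcond ler_sum //= => i _.
    by case: ifP.
  rewrite scaler_suml [RHS]big_mkcond; apply: eq_bigr => i _.
  by case: eqP => [->//|pi]; case: (pg i) => // ->; rewrite scaler0.
rewrite (_ : _ *: _ = l *: g + (1 - l) *: 0); last by rewrite scaler0 addr0.
by apply: conv_convex => //; apply: sub_conv; [right|left].
Qed.

End Minkowski.

Section Levels.
Context {n : nat}.
Implicit Types (S : seq {set 'I_n}) (rho : 'I_n -> nat).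

(** Level function of an ordered set partition: the index of the block. *)
Definition lev S (j : 'I_n) : nat := find (fun B : {set 'I_n} => j \in B) S.

(** The values of [rho] form an initial segment of the natural numbers; these
    are the level functions of ordered set partitions. *)
Definition gapless rho := forall j m, (m < rho j)%N -> exists i, rho i = m.

(** The chain of complete bipartite graphs between consecutive levels. *)
Definition edges rho : {set 'I_n * 'I_n} := [set p | rho p.2 == (rho p.1).+1]%SET.

Lemma osp_nth_neq0 S i : ordered_set_partition S -> (i < size S)%N ->
  nth finset.set0 S i != finset.set0.
Proof. by move=> /and3P[/all_nthP H _ _]; exact: H. Qed.

Lemma lev_lt S j : ordered_set_partition S -> (lev S j < size S)%N.
Proof.
move=> /and3P[_ _ /eqP U]; rewrite /lev -has_find.
have : j \in \big[@finset.setU _/finset.set0]_(B <- S) B by rewrite U inE.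
elim: S {U} => [|B S IH]; first by rewrite big_nil inE.
by rewrite big_cons inE => /orP[/= ->//|/IH /= ->]; rewrite orbT.
Qed.

Lemma mem_lev S j : ordered_set_partition S -> j \in nth finset.set0 S (lev S j).
Proof.
move=> oS; have := lev_lt j oS; rewrite /lev -has_find; exact: (@nth_find _ finset.set0).
Qed.

Lemma mem_block S i j : ordered_set_partition S -> (i < size S)%N ->
  (j \in nth finset.set0 S i) = (lev S j == i).
Proof.
move=> oS iS; apply/idP/eqP => [ji|<-]; last exact: mem_lev.
have li : (lev S j <= i)%N.
  by rewrite leqNgt; apply/negP => /(before_find finset.set0); rewrite ji.
apply/eqP; rewrite eqn_leq li leqNgt; apply/negP => lt_i.
have /and3P[_ /(pairwiseP finset.set0) /(_ _ _ _ _ lt_i) D _] := oS.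
have /setP/(_ j) := eqP (D (lev_lt j oS) iS).
by rewrite !inE mem_lev // ji.
Qed.

Lemma lev_gapless S : ordered_set_partition S -> gapless (lev S).
Proof.
move=> oS j m mj; have mS : (m < size S)%N := ltn_trans mj (lev_lt j oS).
have /set0Pn[i] := osp_nth_neq0 oS mS.
by rewrite mem_block // => /eqP <-; exists i.
Qed.

Lemma lev_surj S m : ordered_set_partition S -> (m < size S)%N ->
  exists j, lev S j = m.
Proof.
move=> oS mS; have /set0Pn[i] := osp_nth_neq0 oS mS.
by rewrite mem_block // => /eqP <-; exists i.
Qed.

Lemma gapless_lt rho j : gapless rho -> (rho j < n)%N.
Proof.
move=> gl; have ch (m : 'I_(rho j).+1) : exists i, rho i == m.
  have := ltn_ord m; rewrite ltnS leq_eqVlt => /orP[/eqP ->|/gl[i <-]].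
    by exists j.
  by exists i.
pose f m := xchoose (ch m).
have finj : injective f.
  move=> m m' /(congr1 rho); rewrite (eqP (xchooseP (ch m))) (eqP (xchooseP (ch m'))).
  exact: val_inj.
by have := leq_card _ finj; rewrite !card_ord.
Qed.

Lemma osp_of_levels rho : gapless rho -> (exists j, rho j = 2) ->
  exists S, [/\ ordered_set_partition S, (3 <= size S)%N & lev S = rho].
Proof.
move=> gl [j2 rj2]; pose m := (\max_j rho j).+1.
have rm j : (rho j < m)%N by rewrite ltnS leq_bigmax.
have [jm rjm] : exists j, rho j = m.-1.
  have [|j jE] := @bigop.eq_bigmax 'I_n rho; last by exists j; rewrite -jE.
  by rewrite card_ord (leq_ltn_trans _ (ltn_ord j2)).
pose S := mkseq (fun i => [set j | rho j == i]%SET) m.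
have sS : size S = m by rewrite size_mkseq.
have nS i : (i < m)%N -> nth finset.set0 S i = [set j | rho j == i]%SET.
  by move=> im; rewrite nth_mkseq.
have oS : ordered_set_partition S.
  apply/and3P; split.
  - apply/(all_nthP finset.set0) => i; rewrite sS => im; rewrite nS //.
    apply/set0Pn; move: im; rewrite ltnS leq_eqVlt => /orP[/eqP ->|im].
      by exists jm; rewrite inE rjm.
    by have [|j <-] := gl jm i; [rewrite rjm|exists j; rewrite inE].
  - apply/(pairwiseP finset.set0) => i i'; rewrite !inE sS => im im' ii'.
    rewrite !nS //; apply/eqP/setP => j; rewrite !inE.
    by apply/negP => /andP[/eqP -> /eqP E]; rewrite E ltnn in ii'.
  - apply/eqP/setP => j; rewrite inE.
    rewrite /S /mkseq big_map -[m in iota 0 m]subn0 -/(index_iota 0 m) big_mkord.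
    by apply/finset.bigcupP; exists (Ordinal (rm j)); rewrite ?inE.
exists S; split=> //; first by have := rm j2; rewrite rj2 sS.
apply/funext => j; apply/eqP; rewrite -mem_block ?sS //.
by rewrite nS // inE.
Qed.

End Levels.

Section ApexTruncation.
Context {R : realType} {n : nat}.
Variable S : seq {set 'I_n}.
Hypothesis oS : ordered_set_partition S.

Lemma osp_vecE j : osp_vec R S 0 j = (lev S j)%:R.
Proof.
rewrite /osp_vec summxE (bigD1 (Ordinal (lev_lt j oS))) //= big1.
  by rewrite addr0 mxE indic_vecE mem_lev // mulr1.
move=> i ij; rewrite mxE indic_vecE mem_block // eq_sym.
by case: eqP => [E|_]; [rewrite -val_eqE /= E eqxx in ij|rewrite mulr0].
Qed.

Lemma big_consecutive_blocks (T : Type) (idx : T) (op : Monoid.com_law idx)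
    (G : 'I_n -> 'I_n -> T) :
  \big[op/idx]_(i < (size S).-1) \big[op/idx]_(a in nth finset.set0 S i)
    \big[op/idx]_(b in nth finset.set0 S i.+1) G a b =
  \big[op/idx]_(p in edges (lev S)) G p.1 p.2.
Proof.
have sS (i : 'I_(size S).-1) : (i.+1 < size S)%N.
  by have := ltn_ord i; rewrite ltn_predRL.
rewrite (eq_bigr (fun i : 'I__ => \big[op/idx]_(a | lev S a == i)
    \big[op/idx]_(b | lev S b == i.+1) G a b)) => [|i _]; last first.
  rewrite (eq_bigl (fun a => lev S a == i)) => [|a]; last by rewrite mem_block // ltnW.
  by apply: eq_bigr => a _; apply: eq_bigl => b; rewrite mem_block.
under [RHS]eq_bigl do rewrite inE.
rewrite -(pair_big_dep xpredT (fun a b => lev S b == (lev S a).+1) G) /=.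
rewrite (exchange_big_dep xpredT) //=; apply: eq_bigr => a _.
have [la|la] := ltnP (lev S a) (size S).-1.
  by rewrite (big_pred1 (Ordinal la)) // => i; rewrite eq_sym.
rewrite big_pred0 => [|i]; last first.
  by apply/eqP => E; have := ltn_ord i; rewrite -E ltnNge la.
rewrite big_pred0 // => b; apply/eqP => E.
have := lev_lt b oS; rewrite E ltnNge; case/negP.
by move: la; case: (size S).
Qed.

Lemma zonotopeP x : zonotope R S x <->
  exists2 l : 'I_n * 'I_n -> R, (forall p, 0 <= l p <= 1) &
    x = \sum_(p in edges (lev S)) l p *: edge_vec p.
Proof.
rewrite /zonotope (big_consecutive_blocks _ (fun a b => conv [set 0; evec R b - evec R a])).
split=> [/big_minkowskiP[y Ay ->]|[l l01 ->]].
  pose l p := if pselect (p \in edges (lev S)) is left pE then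
    projT1 (cid2 ((conv_segmentP _ _).1 (Ay p pE))) else 0.
  exists l => [p|].
    rewrite /l; case: pselect => [pE|_]; last by rewrite lexx ler01.
    by case: cid2.
  apply: eq_bigr => p pE; rewrite /l; case: pselect => // pE'.
  by case: cid2.
apply/big_minkowskiP; exists (fun p => l p *: edge_vec p) => // p pE.
by apply/conv_segmentP; exists (l p).
Qed.

Lemma apex_truncationE : apex_truncation R S = trunc_zonotope (edges (lev S)).
Proof.
have dotE p : p \in edges (lev S) -> dot (osp_vec R S) (edge_vec p) = 1.
  rewrite inE dot_edge_vec /gap !osp_vecE => /eqP ->.
  by rewrite -natrB // subSn // subnn.
apply/seteqP; split=> [x [/zonotopeP[l l01 ->]]|x].
  rewrite dot_sumr => ge1; apply: trunc_zonotopeI => //.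
  move: ge1; congr (_ <= _); apply: eq_bigr => p pE.
  by rewrite dotZr dotE // mulr1.
move=> [k [p [c [Ap c0 c1 ->]]]].
have [A AE] := choice (fun i => let: ex_intro2 A H E := Ap i in
  ex_intro (fun A : {set 'I_n * 'I_n} => (A != finset.set0 /\ A \subset edges (lev S)) /\
     \sum_(q in A) edge_vec q = p i) A (conj H E)).
split; last first.
  rewrite dot_sumr -c1; apply: ler_sum => i _; rewrite dotZr ler_peMr //.
  have [[/set0Pn[q qA] /fintype.subsetP AsE] <-] := AE i.
  rewrite dot_sumr (bigD1 q) //= dotE ?AsE // lerDl sumr_ge0 // => q' /andP[q'A _].
  by rewrite dotE ?AsE.
apply/zonotopeP; exists (fun q => \sum_i c i * (q \in A i)%:R) => [q|].
  rewrite sumr_ge0 /= => [|i _]; last by rewrite mulr_ge0 ?ler0n.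
  by rewrite -[leRHS]c1 ler_sum // => i _; case: (q \in A i); rewrite ?mulr1 ?mulr0.
under [RHS]eq_bigr do rewrite scaler_suml.
rewrite exchange_big /=; apply: eq_bigr => i _.
have [[_ /fintype.subsetP AsE] <-] := AE i.
rewrite scaler_sumr big_mkcond [RHS]big_mkcond /=; apply: eq_bigr => q _.
have [qA|qA] := boolP (q \in A i); first by rewrite AsE // mulr1.
by rewrite mulr0 scale0r if_same.
Qed.

End ApexTruncation.

(** * Simplices, levels of flags and refinement *)

Section Simplices.
Context {R : realType} {n : nat}.
Implicit Types (u v : 'rV[R]_n) (I : {set 'I_n}).

Lemma polytope_simplex I : I != finset.set0 -> polytope (simplex R I).
Proof.
move=> /set0Pn[i iI]; exists [set evec R i | i in [set` I]]; split=> //.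
  by apply: finite_image; exact: finite_finset.
by exists (evec R i), i.
Qed.

Lemma support_simplex I v i : i \in I -> (forall j, j \in I -> v 0 i <= v 0 j) ->
  support_fun (simplex R I) v = v 0 i.
Proof.
move=> iI imin; rewrite -[RHS]dot_evec; apply: support_funE; split.
  by apply: sub_conv; exists i.
by apply: dot_conv_ge => _ [j jI <-]; rewrite !dot_evec imin.
Qed.

Lemma support_simplexP I v : I != finset.set0 -> exists2 i, i \in I &
  support_fun (simplex R I) v = v 0 i /\ forall j, j \in I -> v 0 i <= v 0 j.
Proof.
move=> /set0Pn[i0 i0I].
have [i iI imin] := arg_minP (fun i => v 0 i) i0I.
by exists i => //; split=> //; exact: support_simplex.
Qed.

Lemma support_simplex1 v i : support_fun (simplex R [set i]%SET) v = v 0 i.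
Proof. by apply: support_simplex => [|j]; rewrite inE // => /eqP ->. Qed.

Lemma support_simplex2 v p : support_fun (simplex R [set p.1; p.2]%SET) v =
  v 0 p.1 + Num.min 0 (gap v p).
Proof.
rewrite /gap; case: (leP 0 (v 0 p.2 - v 0 p.1)) => H.
  rewrite addr0; apply: support_simplex => [|j]; rewrite !inE ?eqxx //.
  by move=> /orP[]/eqP -> //; lra.
rewrite addrC subrK; apply: support_simplex => [|j]; rewrite !inE ?eqxx ?orbT //.
by move=> /orP[]/eqP -> //; lra.
Qed.

Lemma support_simplex_indic I (T : {set 'I_n}) : I != finset.set0 ->
  support_fun (simplex R I) (indic_vec R T) = (I \subset T)%:R.
Proof.
move=> I0; have [i iI [-> imin]] := support_simplexP (indic_vec R T) I0.
rewrite indic_vecE; congr (nat_of_bool _)%:R; apply/idP/fintype.subsetP => [iT j jI|].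
  by have := imin j jI; rewrite !indic_vecE iT; case: (j \in T) => //; rewrite /= ler10.
exact.
Qed.

End Simplices.

Section FlagLevels.
Context {n : nat}.
Implicit Types (F G : {set {set 'I_n}}).

(** The [j]-th coordinate of [u_F]. *)
Definition flag_lev F (j : 'I_n) : nat := #|[set T in F | j \in T]%SET|.

Lemma flag_mono G a b : is_flag G -> (flag_lev G a <= flag_lev G b)%N ->
  forall T, T \in G -> a \in T -> b \in T.
Proof.
move=> /is_flagP[_ _ Gch] le_ab T TG aT; apply: contraTT le_ab => bT.
rewrite -ltnNge; apply: proper_card; apply/fintype.properP; split; last first.
  by exists T; rewrite !inE TG.
apply/fintype.subsetP => T'; rewrite !inE => /andP[T'G bT']; rewrite T'G.
have /orP[/fintype.subsetP H|/fintype.subsetP H] := Gch _ _ TG T'G; first by rewrite H.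
by rewrite H in bT.
Qed.

(** Inside a flag [G] with [a] below [b], the levels of [a] and [b] in a subflag
    stay in this order, and their difference grows with the subflag. *)
Lemma flag_lev_sub G F F' a b : is_flag G -> F \subset F' -> F' \subset G ->
  (flag_lev G a <= flag_lev G b)%N ->
  (flag_lev F a <= flag_lev F b)%N /\
  (flag_lev F b + flag_lev F' a <= flag_lev F' b + flag_lev F a)%N.
Proof.
move=> flG FF' F'G /(flag_mono flG) H.
have dec (K : {set {set 'I_n}}) : K \subset G -> flag_lev K b =
    (flag_lev K a + #|[set T in K | (b \in T) && (a \notin T)]%SET|)%N.
  move=> /fintype.subsetP KG; rewrite /flag_lev.
  rewrite -(cardsID [set T : {set 'I_n} | a \in T]%SET [set T in K | b \in T]%SET).
  congr (_ + _)%N; apply: eq_card => T; rewrite !inE.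
    have [TK|//] := boolP (T \in K); have := H T (KG _ TK).
    by case: (a \in T); rewrite ?andbF ?andbT // => ->.
  by case: (T \in K); case: (a \in T); rewrite ?andbF ?andbT.
have FG := fintype.subset_trans FF' F'G.
rewrite !dec // leq_addr; split=> //.
rewrite -!addnA [X in (_ <= _ + X)%N]addnC [X in (_ + X <= _)%N]addnC.
rewrite !addnA [X in (X + _ <= _)%N]addnC leq_add2l.
apply: subset_leq_card; apply/fintype.subsetP => T; rewrite !inE.
by move=> /andP[/(fintype.subsetP FF') -> ].
Qed.

Lemma flag_lev_gapless F : is_flag F -> gapless (flag_lev F).
Proof.
move=> /is_flagP[F0 FT Fch] j m.
suff step s : (0 < s)%N -> (exists j, flag_lev F j = s) ->
    exists i, flag_lev F i = s.-1.
  have [k] := ubnP (flag_lev F j).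
  elim: k j => // k IH j /ltnSE jk mj.
  have [|i iE] := step _ (leq_ltn_trans (leq0n m) mj); first by exists j.
  have jE : flag_lev F j = (flag_lev F i).+1 by rewrite iE prednK // (leq_ltn_trans _ mj).
  move: mj; rewrite jE ltnS leq_eqVlt => /orP[/eqP ->|mi]; first by exists i.
  by apply: IH mi; rewrite -jE.
move=> s0 [{}j js].
pose B i := [set T in F | i \in T]%SET.
have [T0 T0B] : exists T, T \in B j by apply/set0Pn; rewrite -card_gt0 -/(flag_lev F j) js.
have cmp T T' i : T \in B j -> i \notin T -> T' \in B i -> T \subset T'.
  rewrite !inE => /andP[TF jT] iT /andP[T'F iT'].
  by have /orP[//|/fintype.subsetP/(_ i iT')] := Fch _ _ TF T'F; rewrite (negbTE iT).
have sub T i : T \in B j -> i \notin T -> B i \proper B j.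
  move=> TB iT; apply/fintype.properP; split; last by exists T; rewrite // inE (negbTE iT) andbF.
  apply/fintype.subsetP => T' T'i; have /fintype.subsetP TT' := cmp _ _ _ TB iT T'i.
  by move: TB T'i; rewrite !inE => /andP[_ /TT' ->] /andP[->].
have [i0 i0P] : exists i, B i \proper B j.
  have /andP[T0F _] : (T0 \in F) && (j \in T0) by rewrite inE in T0B.
  have /fintype.subsetPn[i _ iT0] : ~~ ([set: 'I_n]%SET \subset T0).
    by rewrite finset.subTset FT.
  by exists i; exact: sub T0B iT0.
have [i iP imax] := arg_maxP (P := fun i => B i \proper B j) (fun i => #|B i|) i0P.
exists i; apply/eqP; rewrite eqn_leq; apply/andP; split.
  by rewrite -ltnS prednK // -js; exact: proper_card.
rewrite leqNgt; apply/negP => lt_is.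
(* otherwise two sets T1, T2 of the flag contain j but not i, and an element
   of T2 outside T1 has a higher level than i, still below that of j *)
have : (1 < #|B j :\: B i|)%N.
  rewrite cardsD (finset.setIidPr (proper_sub iP)) -/(flag_lev F j) js.
  by rewrite ltn_subRL addn1 -ltn_predRL.
move=> /card_gt1P[T1 [T2 []]]; wlog T12 : T1 T2 / T1 \subset T2.
  move=> W T1B T2B T12.
  have [T1F T2F] : T1 \in F /\ T2 \in F.
    by move: T1B T2B; rewrite !inE => /and3P[_ -> _] /and3P[_ ->].
  by have /orP[?|?] := Fch _ _ T1F T2F; [apply: (W T1 T2)|apply: (W T2 T1) => //; rewrite eq_sym].
rewrite !finset.in_setD => /andP[T1i T1j] /andP[T2i T2j] T1neq.
have iT T : T \in B j -> T \notin B i -> i \notin T.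
  by rewrite !inE => /andP[-> _].
have /fintype.properP[_ [y yT2 yT1]] : T1 \proper T2.
  by rewrite finset.properEneq T1neq.
have : (#|B y| <= #|B i|)%N := imax y (sub _ _ T1j yT1); rewrite leqNgt; case/negP.
apply: proper_card; apply/fintype.properP; split; last first.
  by exists T2 => //; move: T2j; rewrite !inE yT2 => /andP[->].
apply/fintype.subsetP => T Ti; have /fintype.subsetP T2T := cmp _ _ _ T2j (iT _ T2j T2i) Ti.
by move: Ti; rewrite !inE => /andP[-> _]; exact: T2T.
Qed.

Lemma chain_max (X : finType) (C : {set {set X}}) : C != finset.set0 ->
  (forall A B, A \in C -> B \in C -> (A \subset B) || (B \subset A)) ->
  exists2 A, A \in C & forall B, B \in C -> B \subset A.
Proof.
move=> /set0Pn[A0 A0C] Cch.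
have [A AC Amax] := arg_maxP (fun A : {set X} => #|A|) A0C.
exists A => // B BC; have /orP[//|AB] := Cch _ _ BC AC.
have /eqP -> // : A == B.
by rewrite eqEcard AB /=; exact: Amax.
Qed.

End FlagLevels.

Section Refinement.
Context {n : nat}.
Implicit Types rho sigma : 'I_n -> nat.

(** The ordered partition with levels [sigma] refines the one with levels
    [rho]. *)
Definition refines rho sigma := [forall p in edges rho, (sigma p.1 < sigma p.2)%N].

Lemma refines_lt rho sigma a b : gapless rho -> refines rho sigma ->
  (rho a < rho b)%N -> (sigma a < sigma b)%N.
Proof.
move=> gl /forall_inP ref; have [k] := ubnP (rho b).
elim: k b => // k IH b /ltnSE bk ab.
have edge c : rho b = (rho c).+1 -> (sigma c < sigma b)%N.
  by move=> bE; apply: (ref (c, b)); rewrite inE bE.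
move: (ab); rewrite leq_eqVlt => /orP[/eqP/esym/edge //|ab'].
have [c cE] := gl b (rho b).-1 ltac:(by rewrite prednK // (leq_ltn_trans _ ab)).
have bE : rho b = (rho c).+1 by rewrite cE prednK // (leq_ltn_trans _ ab).
apply: ltn_trans (edge c bE); apply: IH; first by rewrite -bE.
by move: ab'; rewrite bE ltnS.
Qed.

(** If [sigma] refines [rho], then consecutive blocks of [rho] contain
    consecutive blocks of [sigma]. *)
Lemma refines_adjacent rho sigma p : gapless rho -> gapless sigma ->
  refines rho sigma -> p \in edges rho ->
  exists q, [/\ q \in edges rho, sigma q.2 = (sigma q.1).+1,
                (sigma p.1 <= sigma q.1)%N & (sigma q.2 <= sigma p.2)%N].
Proof.
case: p => a b gr gs ref abE; move: (abE); rewrite inE /= => /eqP ab.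
have [b' /eqP b'E b'min] := arg_minP (P := fun c => rho c == rho b) sigma (eqxx (rho b)).
have lt a' : rho a' = rho a -> (sigma a' < sigma b')%N.
  by move=> a'E; apply: refines_lt gr ref _; rewrite b'E ab a'E.
have [a' a'E] := gs b' (sigma b').-1 ltac:(by rewrite prednK // (leq_ltn_trans _ (lt a erefl))).
have b'S : sigma b' = (sigma a').+1 by rewrite a'E prednK // (leq_ltn_trans _ (lt a erefl)).
have ra' : rho a' = rho a.
  apply/eqP; rewrite eqn_leq; apply/andP; split.
    rewrite -ltnS -ab leqNgt; apply/negP => ab'.
    suff : (sigma b' <= sigma a')%N by rewrite b'S ltnn.
    move: ab'; rewrite ltnS leq_eqVlt => /orP[/eqP E|ab'].
      by apply: b'min; rewrite E.
    by apply/ltnW/(refines_lt gr ref); rewrite b'E.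
  rewrite leqNgt; apply/negP => /(refines_lt gr ref).
  by rewrite ltnNge -ltnS -b'S lt.
exists (a', b'); split=> //=; first by rewrite inE /= b'E ab ra'.
  by rewrite -ltnS -b'S lt.
by apply: b'min.
Qed.

Lemma refines_le rho sigma j : gapless rho -> refines rho sigma ->
  (rho j <= sigma j)%N.
Proof.
move=> gr /forall_inP ref; have [k] := ubnP (rho j).
elim: k j => // k IH j /ltnSE jk.
have [->//|j0] := posnP (rho j).
have [i iE] := gr j (rho j).-1 ltac:(by rewrite prednK).
have ij : (i, j) \in edges rho by rewrite inE /= iE prednK.
apply: leq_trans (ref _ ij) => /=.
rewrite -[leqLHS](prednK j0) -iE ltnS; apply: IH.
by rewrite iE prednK.
Qed.

End Refinement.

(** * Linearity on the cones of the 2-braid fan *)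

Section ChainAdditive.
Context {R : realType} {n : nat}.
Implicit Types (u v : 'rV[R]_n) (f g : 'rV[R]_n -> R).
Implicit Types (rho sigma : 'I_n -> nat).

(** The vector [u] of the ordered set partition with level function [rho]. *)
Definition level_vec rho : 'rV[R]_n := \row_j (rho j)%:R.

Lemma flag_vec_level (F : {set {set 'I_n}}) : flag_vec R F = level_vec (flag_lev F).
Proof. by apply/rowP => j; rewrite flag_vecE mxE. Qed.

Lemma gap_level_vec rho p : gap (level_vec rho) p = (rho p.2)%:R - (rho p.1)%:R.
Proof. by rewrite /gap !mxE. Qed.

Lemma gap_chain_cone (C : {set {set {set 'I_n}}}) (c : {set {set 'I_n}} -> R) (t : R) p :
  gap (\sum_(F in C) c F *: flag_vec R F + t *: indic_vec R finset.setT) p =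
  \sum_(F in C) c F * gap (flag_vec R F) p.
Proof.
rewrite gapD gapZ gap_all_ones mulr0 addr0 /gap !summxE -sumrB.
by apply: eq_bigr => F _; rewrite !mxE -mulrBr.
Qed.

Lemma eq_chain_additive f g : f =1 g -> chain_additive f -> chain_additive g.
Proof. by move=> /funext ->. Qed.

Lemma chain_additiveD f g : chain_additive f -> chain_additive g ->
  chain_additive (fun v => f v + g v).
Proof.
move=> fa ga C c t chC c0; rewrite fa // ga // mulrDr addrACA -big_split /=.
by congr (_ + _); apply: eq_bigr => F _; rewrite mulrDr.
Qed.

Lemma chain_additiveZ (a : R) f : chain_additive f -> chain_additive (fun v => a * f v).
Proof.
move=> fa C c t chC c0; rewrite fa // mulrDr mulr_sumr mulrCA.
by congr (_ + _); apply: eq_bigr => F _; rewrite mulrCA.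
Qed.

Lemma chain_additive_sum (I : Type) (r : seq I) (P : pred I) (G : I -> 'rV[R]_n -> R) :
  (forall i, P i -> chain_additive (G i)) ->
  chain_additive (fun v => \sum_(i <- r | P i) G i v).
Proof.
move=> Ga; elim: r => [|i r IH].
  apply: eq_chain_additive (_ : chain_additive (fun=> 0)) => [v|]; first by rewrite big_nil.
  by move=> C c t _ _; rewrite mulr0 addr0 big1 // => F _; rewrite mulr0.
have [Pi|nPi] := boolP (P i).
  by apply: eq_chain_additive (chain_additiveD (Ga i Pi) IH) => v; rewrite big_cons Pi.
by apply: eq_chain_additive IH => v; rewrite big_cons (negbTE nPi).
Qed.

Lemma chain_additive0 f : chain_additive f -> f 0 = 0.
Proof.
move=> fa; have := fa finset.set0 (fun=> 0) 0.
rewrite !big_set0 scale0r mul0r !addr0; apply=> //.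
by apply/is_flag_chainP; split=> F; rewrite inE.
Qed.

(** An index of [I] of least level in the largest flag of a chain is of least
    level in all of them. *)
Lemma simplex_chain_additive (I : {set 'I_n}) : I != finset.set0 ->
  chain_additive (support_fun (simplex R I)).
Proof.
move=> /set0Pn[i0 i0I] C c t /is_flag_chainP[_ Cfl Cch] c0.
have [i iI imin] : exists2 i, i \in I & forall F j, F \in C -> j \in I ->
    (flag_lev F i <= flag_lev F j)%N.
  have [->|C0] := eqVneq C finset.set0; first by exists i0 => // F j; rewrite inE.
  have [G GC Gmax] := chain_max C0 Cch.
  have [i iI imin] := arg_minP (flag_lev G) i0I.
  exists i => // F j FC jI.
  by have [] := flag_lev_sub (Cfl _ GC) (fintype.subxx F) (Gmax F FC) (imin j jI).
have FE F j : F \in C -> j \in I -> flag_vec R F 0 i <= flag_vec R F 0 j.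
  by move=> FC jI; rewrite flag_vec_level !mxE ler_nat imin.
rewrite (support_simplex (i := i)) // => [|j jI].
  rewrite (support_simplex (i := i)) // => [|j _]; last by rewrite !indic_vecE !inE.
  rewrite mxE summxE; congr (_ + _); last by rewrite mxE.
  apply: eq_bigr => F FC; rewrite (support_simplex (i := i)) ?mxE // => j.
  exact: FE.
rewrite !mxE !indic_vecE !inE lerD2r !summxE; apply: ler_sum => F FC.
by rewrite !mxE ler_wpM2l // FE.
Qed.

Lemma min_gap_level_vec rho sigma : gapless rho -> gapless sigma ->
  edges rho != finset.set0 ->
  min_gap (edges rho) (level_vec sigma) = (refines rho sigma)%:R.
Proof.
move=> gr gs E0; have [ref|nref] := boolP (refines rho sigma); last first.
  have /forall_inPn[p pE] := nref; rewrite -leqNgt => ps.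
  by apply: (min_gap_eq0 pE); rewrite gap_level_vec subr_le0 ler_nat.
have /set0Pn[p pE] := E0.
have [q [qE q1 _ _]] := refines_adjacent gr gs ref pE.
have g1 : gap (level_vec sigma) q = 1 by rewrite gap_level_vec q1 -natrB // subSnn.
rewrite (min_gap_eq qE); first by rewrite g1; apply/max_idPr/ler01.
move=> q' q'E; rewrite g1 gap_level_vec lerBrDr -(natrD _ 1) ler_nat add1n.
by have /forall_inP := ref; apply.
Qed.

(** If the largest flag of a chain does not refine [rho], then both sides vanish.
    Otherwise an edge of slope 1 for the largest flag and of slope 0 for the
    largest flag that does not refine [rho], if any, is of least slope for all
    flags of the chain. *)
Lemma min_gap_chain_additive rho : gapless rho -> edges rho != finset.set0 ->
  chain_additive (min_gap (R := R) (edges rho)).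
Proof.
move=> gr E0 C c t /is_flag_chainP[_ Cfl Cch] c0.
have /set0Pn[p0 p0E] := E0.
rewrite (min_gap_eq0 p0E (v := indic_vec R _)) ?gap_all_ones // mulr0 addr0.
have [->|C0] := eqVneq C finset.set0.
  by rewrite !big_set0 add0r (min_gap_eq0 p0E) // gapZ gap_all_ones mulr0.
have [G GC Gmax] := chain_max C0 Cch.
have gl F : F \in C -> gapless (flag_lev F) by move=> FC; apply/flag_lev_gapless/Cfl.
have [ref|/forall_inPn[p pE]] := boolP (refines rho (flag_lev G)); last first.
  rewrite -leqNgt => pG.
  have le F : F \in C -> gap (flag_vec R F) p <= 0.
    move=> FC; rewrite flag_vec_level gap_level_vec subr_le0 ler_nat.
    by have [] := flag_lev_sub (Cfl _ GC) (fintype.subxx F) (Gmax F FC) pG.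
  rewrite (min_gap_eq0 pE); last first.
    rewrite gap_chain_cone; apply: sumr_le0 => F FC.
    by rewrite mulr_ge0_le0 ?le.
  by rewrite big1 // => F FC; rewrite (min_gap_eq0 pE) ?mulr0 ?le.
have lt p : p \in edges rho -> (flag_lev G p.1 < flag_lev G p.2)%N.
  by move=> pE; have /forall_inP := ref; apply.
have gap0 F p : F \in C -> p \in edges rho -> 0 <= gap (flag_vec R F) p.
  move=> FC pE; rewrite flag_vec_level gap_level_vec subr_ge0 ler_nat.
  by have [] := flag_lev_sub (Cfl _ GC) (fintype.subxx F) (Gmax F FC) (ltnW (lt p pE)).
have [q qE qmin] : exists2 q, q \in edges rho & forall F, F \in C ->
    gap (flag_vec R F) q = min_gap (edges rho) (flag_vec R F).
  pose N := [set F in C | ~~ refines rho (flag_lev F)]%SET.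
  have NC F : F \in N -> F \in C by rewrite inE => /andP[].
  have refE F : F \in C -> F \notin N -> refines rho (flag_lev F).
    by move=> FC; rewrite inE FC negbK.
  have step q F : q \in edges rho -> flag_lev G q.2 = (flag_lev G q.1).+1 ->
      F \in C -> refines rho (flag_lev F) ->
      gap (flag_vec R F) q = min_gap (edges rho) (flag_vec R F).
    move=> qE qS FC refF; rewrite flag_vec_level min_gap_level_vec ?refF;
      [|exact: gr|exact: gl|by []].
    have /forall_inP/(_ q qE) ltF := refF.
    have [_] := flag_lev_sub (Cfl _ GC) (Gmax F FC) (fintype.subxx G) (ltnW (lt q qE)).
    rewrite qS addSnnS addnC leq_add2l => leF.
    rewrite gap_level_vec; have -> : flag_lev F q.2 = (flag_lev F q.1).+1.
      by apply/eqP; rewrite eqn_leq ltF andbT.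
    by rewrite -natrB // subSnn.
  have [N0|N0] := eqVneq N finset.set0.
    have [q [qE qS _ _]] := refines_adjacent gr (gl G GC) ref p0E.
    by exists q => // F FC; apply: step => //; apply: refE; rewrite // N0 inE.
  have [H HN Hmax] := chain_max N0 (fun A B AN BN => Cch A B (NC A AN) (NC B BN)).
  have /forall_inPn[p pE] : ~~ refines rho (flag_lev H).
    by move: HN; rewrite inE => /andP[].
  rewrite -leqNgt => pH.
  have mono a b : (flag_lev G a <= flag_lev G b)%N -> (flag_lev H a <= flag_lev H b)%N.
    by move=> ab; have [] := flag_lev_sub (Cfl _ GC) (fintype.subxx H) (Gmax H (NC H HN)) ab.
  have [q [qE qS q1 q2]] := refines_adjacent gr (gl G GC) ref pE.
  have qH : (flag_lev H q.2 <= flag_lev H q.1)%N.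
    exact: leq_trans (mono _ _ q2) (leq_trans pH (mono _ _ q1)).
  exists q => // F FC; have [FN|FN] := boolP (F \in N); last exact/step/refE.
  have nref : refines rho (flag_lev F) = false.
    by apply/negbTE; move: FN; rewrite inE => /andP[].
  have [_ qF] := flag_lev_sub (Cfl _ GC) (Hmax F FN) (Gmax H (NC H HN)) (ltnW (lt q qE)).
  apply/eqP; rewrite [X in min_gap _ X]flag_vec_level min_gap_level_vec //; last exact: gl.
  rewrite nref eq_le gap0 // andbT flag_vec_level gap_level_vec.
  rewrite subr_le0 ler_nat -(leq_add2r (flag_lev H q.1)) (leq_trans qF) //.
  by rewrite addnC leq_add2l.
have gapE : gap (\sum_(F in C) c F *: flag_vec R F + t *: indic_vec R finset.setT) q =
    \sum_(F in C) c F * min_gap (edges rho) (flag_vec R F).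
  by rewrite gap_chain_cone; apply: eq_bigr => F FC; rewrite qmin.
rewrite (min_gap_eq qE); first rewrite gapE.
  by apply/max_idPr/sumr_ge0 => F _; rewrite mulr_ge0 ?min_gap_ge0.
move=> p pE; rewrite gapE gap_chain_cone; apply: ler_sum => F FC.
by rewrite ler_wpM2l // min_gap_le // gap0.
Qed.

End ChainAdditive.

(** * The basis *)

Section Triangular.
Context {R : realType} {K : finType} (P : pred K) (M : K -> K -> R) (rk : K -> nat).
Hypothesis M1 : forall s, P s -> M s s = 1.
Hypothesis M0 : forall s t, P s -> P t -> M s t != 0 -> s = t \/ (rk s < rk t)%N.

Lemma triangular_indep (c : K -> R) :
  (forall t, P t -> \sum_(s | P s) c s * M s t = 0) -> forall t, P t -> c t = 0.
Proof.
move=> cM t; have [k] := ubnP (rk t); elim: k t => // k IH t /ltnSE tk Pt.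
have := cM t Pt; rewrite (bigD1 t) //= M1 // mulr1 big1 ?addr0 // => s /andP[Ps st].
have [->|Mst] := eqVneq (M s t) 0; first by rewrite mulr0.
have [E|lt_st] := M0 Ps Pt Mst; first by rewrite E eqxx in st.
by rewrite IH ?mul0r // (leq_trans lt_st).
Qed.

Lemma triangular_solve (f : K -> R) :
  exists c : K -> R, forall t, P t -> \sum_(s | P s) c s * M s t = f t.
Proof.
suff [c cM] : exists c : K -> R, forall t, P t -> (rk t < \max_s (rk s).+1)%N ->
    \sum_(s | P s) c s * M s t = f t.
  by exists c => t Pt; apply: cM => //; exact: (bigop.leq_bigmax (F := fun s => (rk s).+1)).
elim: (\max_s _) => [|k [c cM]]; first by exists (fun=> 0).
pose r t := f t - \sum_(s | P s) c s * M s t.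
exists (fun s => c s + (rk s == k)%:R * r s) => t Pt; rewrite ltnS => tk.
under eq_bigr do rewrite mulrDl.
rewrite big_split /= [X in _ + X](_ : _ = (rk t == k)%:R * r t).
  move: tk; rewrite leq_eqVlt; case: eqP => /= [_ _|_ tk]; last by rewrite mul0r addr0 cM.
  by rewrite mul1r /r addrC subrK.
rewrite (bigD1 t) //= M1 // mulr1 big1 ?addr0 // => s /andP[Ps st].
have [->|Mst] := eqVneq (M s t) 0; first by rewrite mulr0.
have [E|lt_st] := M0 Ps Pt Mst; first by rewrite E eqxx in st.
by rewrite ltn_eqF ?mul0r // (leq_trans lt_st).
Qed.

End Triangular.

Section Basis.
Context {R : realType} {n : nat}.
Implicit Types (u v : 'rV[R]_n) (f g : 'rV[R]_n -> R).

(** Labels of the basis: subsets of [n], and level functions of ordered set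
    partitions. *)
Definition label : Type := ({set 'I_n} + {ffun 'I_n -> 'I_n})%type.

Definition label_levels (rho : {ffun 'I_n -> 'I_n}) : 'I_n -> nat := fun j => rho j.

(** The labels that occur: nonempty subsets, and level functions of ordered set
    partitions with at least three blocks. *)
Definition valid_label (s : label) : bool := match s with
  | inl T => T != finset.set0
  | inr rho => `[< gapless (label_levels rho) >] && [exists j, label_levels rho j == 2]
  end.

(** The polytope of a label; by [apex_truncationE] the second case is the apex
    truncation. *)
Definition basis_polytope (s : label) : set 'rV[R]_n := match s with
  | inl T => simplex R T
  | inr rho => trunc_zonotope (edges (label_levels rho))
  end.

(** The support function of the polytope of a label, without the part coming
    from the full zonotope, which is spanned by simplices. *)
Definition reduced_support (s : label) : 'rV[R]_n -> R := match s with
  | inl T => support_fun (simplex R T)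
  | inr rho => min_gap (edges (label_levels rho))
  end.

(** Generators of the 2-braid fan at which functions are tested. *)
Definition test_vec (s : label) : 'rV[R]_n := match s with
  | inl T => indic_vec R T
  | inr rho => level_vec (label_levels rho)
  end.

(** A grading for which the evaluations at the test vectors are triangular. *)
Definition label_rank (s : label) : nat := match s with
  | inl T => #|T|
  | inr rho => (n.+1 + \sum_j label_levels rho j)%N
  end.

(** Coefficients, on the simplices, of the support function of the full
    zonotope: each edge [(a, b)] contributes [min(v_a, v_b) - v_a]. *)
Definition simplex_coef (s t : label) : R := match s, t with
  | inr rho, inl T => \sum_(p in edges (label_levels rho))
      ((T == [set p.1; p.2]%SET)%:R - (T == [set p.1]%SET)%:R)
  | _, _ => 0
  end.

Lemma valid_label_levels rho : valid_label (inr rho) ->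
  gapless (label_levels rho) /\ exists j, label_levels rho j = 2.
Proof. by move=> /andP[/asboolP ? /existsP[j /eqP ?]]; split=> //; exists j. Qed.

Lemma gapless_edge (rho : 'I_n -> nat) m : gapless rho -> (exists j, (m < rho j)%N) ->
  exists2 p, p \in edges rho & rho p.1 = m.
Proof.
move=> gl [j]; rewrite leq_eqVlt => /orP[/eqP mj|/gl[j' j'E]].
  by have [i iE] := gl j m ltac:(by rewrite -mj); exists (i, j); rewrite ?inE //= -mj iE.
by have [i iE] := gl j' m ltac:(by rewrite j'E); exists (i, j'); rewrite ?inE //= j'E iE.
Qed.

Lemma edges_neq0 (rho : 'I_n -> nat) : gapless rho -> (exists j, rho j = 2) ->
  edges rho != finset.set0.
Proof.
move=> gl [j rj].
by have [|p pE _] := gapless_edge (m := 0) gl; [exists j; rewrite rj|apply/set0Pn; exists p].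
Qed.

Lemma valid_label_edges rho : valid_label (inr rho) -> edges (label_levels rho) != finset.set0.
Proof. by move=> /valid_label_levels[]; exact: edges_neq0. Qed.

Lemma polytope_basis_polytope s : valid_label s -> polytope (basis_polytope s).
Proof.
by case: s => [I|rho] vs; [exact: polytope_simplex|exact/polytope_trunc_zonotope/valid_label_edges].
Qed.

Lemma reduced_support_chain_additive s : valid_label s -> chain_additive (reduced_support s).
Proof.
case: s => [I|rho] vs; first exact: simplex_chain_additive.
by apply: min_gap_chain_additive; [case: (valid_label_levels vs)|exact: valid_label_edges].
Qed.

Lemma support_fun_reduced s v : valid_label s ->
  support_fun (basis_polytope s) v =
  reduced_support s v + \sum_(t | valid_label t) simplex_coef s t * reduced_support t v.
Proof.
case: s => [I|rho] vs; first by rewrite big1 ?addr0 // => t _; rewrite mul0r.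
rewrite /= support_trunc_zonotope ?valid_label_edges // addrC; congr (_ + _).
rewrite big_sumType /= [X in _ + X]big1 ?addr0 => [|t _]; last by rewrite mul0r.
under [RHS]eq_bigr do rewrite mulr_suml.
rewrite exchange_big /=; apply: eq_bigr => p pE.
under eq_bigr do rewrite mulrBl.
rewrite sumrB; have pick (J : {set 'I_n}) : J != finset.set0 ->
    \sum_(I | I != finset.set0) (I == J)%:R * support_fun (simplex R I) v =
    support_fun (simplex R J) v.
  move=> J0; rewrite (bigD1 J) //= eqxx mul1r big1 ?addr0 // => I /andP[_ /negbTE ->].
  by rewrite mul0r.
rewrite !pick; try by apply/set0Pn; exists p.1; rewrite !inE eqxx.
by rewrite support_simplex2 support_simplex1 addrAC subrr add0r.
Qed.

Lemma basis_polytope_chain_additive s : valid_label s ->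
  chain_additive (support_fun (basis_polytope s)).
Proof.
move=> vs; apply: eq_chain_additive (_ : chain_additive (fun v =>
  reduced_support s v + \sum_(t | valid_label t) simplex_coef s t * reduced_support t v)) => [v|].
  by rewrite support_fun_reduced.
apply: chain_additiveD; first exact: reduced_support_chain_additive.
apply: chain_additive_sum => t vt; apply: chain_additiveZ.
exact: reduced_support_chain_additive.
Qed.

Lemma reduced_support_test1 s : valid_label s -> reduced_support s (test_vec s) = 1.
Proof.
case: s => [I|rho] vs /=; first by rewrite support_simplex_indic // fintype.subxx.
have [gl _] := valid_label_levels vs.
rewrite min_gap_level_vec ?valid_label_edges //.
suff -> : refines (label_levels rho) (label_levels rho) by [].
by apply/forall_inP => p; rewrite inE => /eqP ->.
Qed.

(** Indicator vectors take only two values, so with at least three blocks some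
    edge has nonpositive slope. *)
Lemma min_gap_01 (rho : 'I_n -> nat) v : gapless rho -> (exists j, rho j = 2) ->
  (forall j, v 0 j = 0 \/ v 0 j = 1) ->
  exists2 p, p \in edges rho & gap v p <= 0.
Proof.
move=> gl [j rj] v01.
have [b bE] := gl j 1 ltac:(by rewrite rj).
have [a aE] := gl j 0 ltac:(by rewrite rj).
have [vb|vb] := v01 b.
  exists (a, b); first by rewrite inE /= bE aE.
  by rewrite /gap /= vb; case: (v01 a) => ->; lra.
exists (b, j); first by rewrite inE /= bE rj.
by rewrite /gap /= vb; case: (v01 j) => ->; lra.
Qed.

Lemma reduced_support_test0 s t : valid_label s -> valid_label t ->
  reduced_support s (test_vec t) != 0 ->
  s = t \/ (label_rank s < label_rank t)%N.
Proof.
case: s t => [I|rho] [T|sigma] vs vt /=.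
- rewrite support_simplex_indic //; have [IT _|] := boolP (I \subset T); last by rewrite eqxx.
  have [->|IneT] := eqVneq I T; [by left|right].
  by apply: proper_card; rewrite finset.properEneq IneT.
- by move=> _; right; rewrite addSn ltnS (leq_trans (max_card _)) // card_ord leq_addr.
- have [gl r2] := valid_label_levels vs.
  have [|p pE pg] := min_gap_01 (v := indic_vec R T) gl r2.
    by move=> j; rewrite indic_vecE; case: (j \in T); [right|left].
  by rewrite (min_gap_eq0 pE) // eqxx.
have [gr _] := valid_label_levels vs; have [gs _] := valid_label_levels vt.
rewrite min_gap_level_vec ?valid_label_edges //.
have [ref _|_] := boolP (refines _ _); last by rewrite eqxx.
have le j : (label_levels rho j <= label_levels sigma j)%N by exact: refines_le.
have [->|rs] := eqVneq rho sigma; [by left|right].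
rewrite ltn_add2l ltn_neqAle leq_sum ?andbT //.
apply: contra rs => /eqP E; apply/eqP/ffunP => j; apply/val_inj/eqP.
have : (\sum_j (label_levels sigma j - label_levels rho j) == 0)%N.
  by rewrite -(eqn_add2l (\sum_j label_levels rho j)%N) -big_split /= addn0 E;
    apply/eqP/eq_bigr => i _; rewrite subnKC.
rewrite sum_nat_eq0 => /forallP/(_ j)/=; rewrite subn_eq0 => ge.
by rewrite eqn_leq ge le.
Qed.

(** The test vectors include all flag vectors, up to 0, so they detect functions
    linear on the cones of the 2-braid fan. *)
Lemma chain_additive_test0 f : chain_additive f ->
  (forall t, valid_label t -> f (test_vec t) = 0) -> forall v, f v = 0.
Proof.
move=> fa f0 v.
have fT (T : {set 'I_n}) : f (indic_vec R T) = 0.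
  have [->|T0] := eqVneq T finset.set0; last exact: (f0 (inl T)).
  by rewrite /indic_vec big_set0 chain_additive0.
have [C [c [t [chC c0 ->]]]] := chain_cone_cover v.
have -> : \sum_(F in C) c F *: flag_vec R F =
    \sum_(F in C) (if F \in C then c F else 0) *: flag_vec R F.
  by apply: eq_bigr => F ->.
rewrite fa // => [|F]; last by case: ifP => // /c0/ltW.
rewrite fT mulr0 addr0 big1 // => F FC; rewrite flag_vec_level.
suff -> : f (level_vec (flag_lev F)) = 0 by rewrite mulr0.
have gl : gapless (flag_lev F).
  by apply: flag_lev_gapless; have /is_flag_chainP[_ + _] := chC; apply.
have [[j j2]|no2] := pselect (exists j, flag_lev F j = 2).
  pose rho := [ffun j => Ordinal (gapless_lt j gl)].
  have rE : label_levels rho = flag_lev F by apply/funext => i; rewrite /label_levels ffunE.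
  have := f0 (inr rho); rewrite /= rE; apply; apply/andP; split; first exact/asboolP.
  by apply/existsP; exists j; rewrite j2.
rewrite -(fT [set j | flag_lev F j == 1]%SET); congr f.
apply/rowP => j; rewrite mxE indic_vecE inE.
case E: (flag_lev F j) => [|[|m]] //; case: no2.
case: m E => [|m] E; first by exists j.
by apply: (gl j); rewrite E.
Qed.

(** The passage from the reduced functions to the support functions is
    unipotent, so both independence and span may be checked on the former,
    whose evaluations at the test vectors are unitriangular. *)
Lemma basis_polytope_indep (c : label -> R) :
  (forall v, \sum_(s | valid_label s) c s * support_fun (basis_polytope s) v = 0) ->
  forall s, valid_label s -> c s = 0.
Proof.
move=> c0; pose d t := c t + \sum_(s | valid_label s) c s * simplex_coef s t.
have d0 t : valid_label t -> d t = 0.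
  apply: (triangular_indep reduced_support_test1 reduced_support_test0) => {}t vt.
  apply: etrans (c0 (test_vec t)); rewrite /d; under eq_bigr do rewrite mulrDl mulr_suml.
  under [RHS]eq_bigr => s vs do rewrite support_fun_reduced // mulrDr mulr_sumr.
  rewrite !big_split /=; congr (_ + _); rewrite exchange_big /=.
  by apply: eq_bigr => s _; apply: eq_bigr => t' _; rewrite mulrA.
have cR rho : valid_label (inr rho) -> c (inr rho) = 0.
  move=> /d0; rewrite /d big1 ?addr0 // => -[I|sigma] _; exact: mulr0.
move=> s /[dup] vs /d0; rewrite /d big1 ?addr0 // => -[I|sigma] vt; first exact: mulr0.
by rewrite cR // mul0r.
Qed.

Lemma basis_polytope_span f : chain_additive f ->
  exists c : label -> R, forall v,
    f v = \sum_(s | valid_label s) c s * support_fun (basis_polytope s) v.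
Proof.
move=> fa.
have [d dE] := triangular_solve reduced_support_test1 reduced_support_test0
  (fun t => f (test_vec t)).
pose c t := d t - \sum_(s | valid_label s) d s * simplex_coef s t.
have cshift s t : c s * simplex_coef s t = d s * simplex_coef s t.
  case: s => [I|rho]; first by rewrite !mulr0.
  by rewrite /c big1 ?subr0 // => -[I|sigma] _; exact: mulr0.
have fE v : f v = \sum_(s | valid_label s) d s * reduced_support s v.
  apply/eqP; rewrite -subr_eq0; apply/eqP.
  pose g v := f v + (-1) * \sum_(s | valid_label s) d s * reduced_support s v.
  rewrite -mulN1r -/(g v); apply: chain_additive_test0 => [|t vt].
    apply: chain_additiveD => //; apply: chain_additiveZ.
    apply: chain_additive_sum => s vs; apply: chain_additiveZ.
    exact: reduced_support_chain_additive.
  by rewrite /g dE // mulN1r subrr.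
exists c => v; rewrite fE.
under [RHS]eq_bigr => s vs do rewrite support_fun_reduced // mulrDr mulr_sumr.
rewrite big_split /=; under [X in _ = _ + X]eq_bigr do under eq_bigr do rewrite mulrA cshift.
rewrite exchange_big /= -big_split /=; apply: eq_bigr => t _.
by rewrite /c mulrBl mulr_suml subrK.
Qed.

End Basis.
Arguments label n : clear implicits.

(** * Indecomposability *)

Section IndecSimplex.
Context {R : realType} {n : nat}.
Implicit Types (u v w : 'rV[R]_n).

Lemma row_sum_evec v : v = \sum_j v 0 j *: evec R j.
Proof.
apply/rowP => i; rewrite summxE (bigD1 i) //= mxE evecE eqxx mulr1 big1 ?addr0 // => j ji.
by rewrite mxE evecE eq_sym (negbTE ji) mulr0.
Qed.

(** Indecomposability as a statement on functions: positively homogeneous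
    functions additive wherever [h_P] is must be multiples of [h_P] up to linear
    forms. *)
Lemma indecomposable_support (P : set 'rV[R]_n) : polytope P ->
  (forall f : 'rV[R]_n -> R,
     (forall (t : R) u, 0 <= t -> f (t *: u) = t * f u) ->
     (forall u w, support_fun P (u + w) = support_fun P u + support_fun P w ->
        f (u + w) = f u + f w) ->
     exists (t : R) v, forall u, f u = dot u v + t * support_fun P u) ->
  indecomposable P.
Proof.
move=> PP H Q defQ; have PQ : polytope Q := defQ.1.
have [t [v fE]] := H (support_fun Q) (fun t u => support_funZ u PQ)
  (fun u w => deformation_additive PP defQ).
exact: homothetic_support fE.
Qed.

(** Subtracting from [u] a multiple of [e_I] reduces to vectors with minimum 0 on
    [I], on which [f] is linear in the coordinates. *)
Lemma indecomposable_simplex (I : {set 'I_n}) : I != finset.set0 ->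
  indecomposable (simplex R I).
Proof.
move=> I0; apply: indecomposable_support; first exact: polytope_simplex.
move=> f fZ fD; set h := support_fun (simplex R I) in fD *.
have f0 : f 0 = 0 by rewrite -(scale0r 0) fZ // mul0r.
have h0 u : (forall j, j \in I -> 0 <= u 0 j) -> (exists2 j, j \in I & u 0 j = 0) -> h u = 0.
  by move=> u0 [j jI uj]; rewrite /h (support_simplex jI) // => i iI; rewrite uj u0.
pose e := indic_vec R I.
have eI j : j \in I -> e 0 j = 1 by rewrite /e indic_vecE => ->.
have hc (t : R) w : (forall j, j \in I -> w 0 j = t) -> h w = t.
  have /set0Pn[i iI] := I0.
  by move=> wt; rewrite /h (support_simplex iI) wt // => j jI; rewrite wt.
have fe (t : R) : f (t *: e) = t * f e.
  have [t0|/ltW t0] := leP 0 t; first by rewrite fZ.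
  have he (s : R) : h (s *: e) = s by apply: hc => j jI; rewrite mxE eI // mulr1.
  have := fD (t *: e) ((- t) *: e); rewrite -scalerDl !he (fZ (- t)) ?oppr_ge0 //.
  by rewrite subrr scale0r f0 mulNr => /(_ erefl)/eqP; rewrite eq_sym subr_eq0 => /eqP.
have fj (t : R) j : (j \in I -> 0 <= t) -> f (t *: evec R j) = t * f (evec R j).
  move=> jt; have [t0|t0] := leP 0 t; first by rewrite fZ.
  have jI : j \notin I by apply/negP => /jt; rewrite leNgt t0.
  have hj (s : R) : h (s *: evec R j) = 0.
    apply: hc => i iI; rewrite mxE evecE.
    by case: eqP jI => [<-|_ _]; rewrite ?iI // mulr0.
  have := fD (t *: evec R j) ((- t) *: evec R j).
  rewrite -scalerDl !hj addr0 (fZ (- t)) ?oppr_ge0 ?ltW // subrr scale0r f0 mulNr.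
  by move=> /(_ erefl) /eqP; rewrite eq_sym subr_eq0 => /eqP.
have fw w : (forall j, j \in I -> 0 <= w 0 j) -> (exists2 j, j \in I & w 0 j = 0) ->
    f w = \sum_j w 0 j * f (evec R j).
  move=> w0 [i iI wi]; rewrite [in LHS](row_sum_evec w).
  have ge0 (r : seq 'I_n) j : j \in I -> 0 <= (\sum_(k <- r) w 0 k *: evec R k) 0 j.
    move=> jI; rewrite summxE; apply: sumr_ge0 => k _; rewrite mxE evecE.
    by case: eqP => [<-|_]; rewrite ?mulr0 // mulr1 w0.
  have z (r : seq 'I_n) : (\sum_(k <- r) w 0 k *: evec R k) 0 i = 0.
    rewrite summxE big1 // => k _; rewrite mxE evecE.
    by case: eqP => [<-|_]; rewrite ?mulr0 // wi mul0r.
  elim: (index_enum _) => [|j r IH]; first by rewrite !big_nil.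
  rewrite !big_cons fD ?IH ?fj //; first exact: w0.
  have H1 : h (\sum_(k <- r) w 0 k *: evec R k) = 0.
    by apply: h0 => [k|]; [exact: ge0|exists i].
  have H2 : h (w 0 j *: evec R j) = 0.
    apply: h0 => [k kI|]; first by have := ge0 [:: j] k kI; rewrite big_seq1.
    by exists i => //; have := z [:: j]; rewrite big_seq1.
  rewrite H1 H2 addr0; apply: h0 => [k kI|]; last first.
    by exists i => //; have := z (j :: r); rewrite big_cons.
  by have := ge0 (j :: r) k kI; rewrite big_cons.
exists (f e - \sum_(j in I) f (evec R j)), (\row_j f (evec R j)) => u.
have [i iI [uE umin]] := support_simplexP u I0.
have uD : u = u 0 i *: e + (u - u 0 i *: e) by rewrite addrC subrK.
have w0 j : j \in I -> 0 <= (u - u 0 i *: e) 0 j.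
  by move=> jI; rewrite !mxE eI // mulr1 subr_ge0 umin.
have wi : exists2 j, j \in I & (u - u 0 i *: e) 0 j = 0.
  by exists i; rewrite // !mxE eI // mulr1 subrr.
rewrite [in LHS]uD fD; last first.
  rewrite -uD (h0 _ w0 wi) addr0 /h uE.
  by apply/esym/hc => j jI; rewrite mxE eI // mulr1.
rewrite fe (fw (u - u 0 i *: e)) // /h uE mulrBl [f e * _]mulrC addrCA; congr (_ + _).
rewrite /dot mulr_suml [X in _ = _ - X]big_mkcond -sumrB; apply: eq_bigr => j _.
by rewrite !mxE indic_vecE; case: (j \in I); rewrite /= ?mulr1 ?mulr0; ring.
Qed.

End IndecSimplex.

Section IndecTruncated.
Context {R : realType} {n : nat} (rho : 'I_n -> nat).
Hypothesis gl : gapless rho.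
Hypothesis r2 : exists j, rho j = 2.
Implicit Types (u v w : 'rV[R]_n) (f : 'rV[R]_n -> R).

Let E := edges rho.
Let g : 'rV[R]_n -> R := min_gap E.

Let E0 : E != finset.set0.
Proof. exact: edges_neq0. Qed.

Lemma edge_neq p : p \in E -> p.1 != p.2.
Proof. by rewrite inE; apply: contraTneq => ->; rewrite ltn_eqF. Qed.

(** The slopes of [u] and [w] along an edge never have opposite signs. *)
Definition compatible u w := forall p, p \in E -> 0 <= gap u p * gap w p.

Lemma min0D (x y : R) : 0 <= x * y -> Num.min 0 (x + y) = Num.min 0 x + Num.min 0 y.
Proof.
by move=> xy; case: (leP 0 x) => x0; case: (leP 0 y) => y0; case: leP => xy0; nra.
Qed.

Lemma compatible_le0 u w p : compatible u w -> p \in E -> gap (u + w) p <= 0 ->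
  gap u p <= 0 /\ gap w p <= 0.
Proof. by move=> cuw pE; have := cuw p pE; rewrite gapD => ? ?; split; nra. Qed.

(** The relations kept when linear forms and multiples of the functions
    [min(v_a, v_b)], for edges [(a, b)], are subtracted from a function additive
    wherever the support function of the truncated zonotope is. *)
Definition tame f := (forall (t : R) u, 0 <= t -> f (t *: u) = t * f u) /\
  forall u w, compatible u w -> g (u + w) = g u + g w -> f (u + w) = f u + f w.

Lemma tame0 f : tame f -> f 0 = 0.
Proof. by move=> [fZ _]; rewrite -(scale0r 0) fZ // mul0r. Qed.

Lemma tame_add f u w p : tame f -> compatible u w -> p \in E -> gap (u + w) p <= 0 ->
  f (u + w) = f u + f w.
Proof.
move=> [_ fD] cuw pE uw0; have [u0 w0] := compatible_le0 cuw pE uw0.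
by apply: fD => //; rewrite /g !(min_gap_eq0 pE) // addr0.
Qed.

Definition is01 u := forall j, u 0 j = 0 \/ u 0 j = 1.

(** The second difference of [f] along two coordinates not joined by an edge
    vanishes, when some edge has nonpositive slope on the sum of the vectors. *)
Lemma tame_exchange_edge f u i j p : tame f -> is01 u -> i != j ->
  (i, j) \notin E -> (j, i) \notin E -> u 0 i = 0 -> u 0 j = 0 ->
  p \in E -> gap (u + evec R i + (u + evec R j)) p <= 0 ->
  f (u + evec R i) + f (u + evec R j) = f (u + evec R i + evec R j) + f u.
Proof.
move=> tf u01 ij ijE jiE ui uj pE le0.
have c q : q \in E -> 0 <= gap (u + evec R i) q * gap (u + evec R j) q /\
    0 <= gap (u + evec R i + evec R j) q * gap u q.
  case: q => a b abE; rewrite /gap !mxE !eqxx /=.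
  have ab := edge_neq abE; rewrite /= in ab.
  have nij : ~~ ((a == i) && (b == j)) by apply: contra ijE => /andP[/eqP<- /eqP<-].
  have nji : ~~ ((a == j) && (b == i)) by apply: contra jiE => /andP[/eqP<- /eqP<-].
  case: (eqVneq a i) (eqVneq a j) (eqVneq b i) (eqVneq b j) nij nji
    => [ai|_] [aj|_] [bi|_] [bj|_] //= _ _;
  (try by rewrite -ai -aj eqxx in ij); (try by rewrite -bi -bj eqxx in ij);
  (try by rewrite ai bi eqxx in ab); (try by rewrite aj bj eqxx in ab);
  rewrite ?ai ?aj ?bi ?bj ?ui ?uj;
  (try by case: (u01 a) => ->; split; lra); (try by case: (u01 b) => ->; split; lra).
  by have := sqr_ge0 (u 0 b - u 0 a); rewrite expr2 !addr0.
have c1 : compatible (u + evec R i) (u + evec R j) by move=> q /c[].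
have c2 : compatible (u + evec R i + evec R j) u by move=> q /c[].
rewrite -(tame_add tf c1 pE le0).
have eq : u + evec R i + (u + evec R j) = u + evec R i + evec R j + u.
  by rewrite [u + evec R j]addrC addrA.
by rewrite eq (tame_add tf c2 pE) // -eq.
Qed.

Lemma gapless_ex m : (m <= 2)%N -> exists j, rho j = m.
Proof.
have [j rj] := r2; rewrite leq_eqVlt => /orP[/eqP ->|m2]; first by exists j.
by apply: (gl (j := j)); rewrite rj.
Qed.

(** The only case not covered by the previous lemma is that of three blocks,
    the middle one being [{i, j}] and the last one the support of [u]; then
    the difference is a combination of second differences of the former kind
    along [(i, j)] and along [(x, c)], with [x] in the last block and [c] in
    the first one. *)
Lemma tame_exchange f u i j : tame f -> is01 u -> i != j ->
  (i, j) \notin E -> (j, i) \notin E -> u 0 i = 0 -> u 0 j = 0 ->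
  f (u + evec R i) + f (u + evec R j) = f (u + evec R i + evec R j) + f u.
Proof.
move=> tf u01 ij ijE jiE ui uj; set w := u + evec R i + (u + evec R j).
have [[p pE wp]|nex] := pselect (exists2 p, p \in E & gap w p <= 0).
  exact: tame_exchange_edge wp.
have lt a b : rho b = (rho a).+1 -> w 0 a < w 0 b.
  move=> ab; rewrite -subr_gt0 ltNge; apply/negP => wab; apply: nex.
  by exists (a, b); rewrite ?inE /= ?ab.
have wE k : w 0 k = u 0 k + u 0 k + (k == i)%:R + (k == j)%:R.
  by rewrite !mxE !eqxx /=; ring.
have no3 (y z : R) : [\/ y = 0, y = 1 | y = 2] -> [\/ z = 0, z = 1 | z = 2] ->
    1 < z -> z < y -> False by case=> ->; case=> ->; lra.
have no3' (y z : R) : [\/ y = 0, y = 1 | y = 2] -> [\/ z = 0, z = 1 | z = 2] ->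
    z < 1 -> y < z -> False by case=> ->; case=> ->; lra.
have w1 k : u 0 k = 0 -> ((k == i) + (k == j) = 1)%N -> rho k = 1.
  move=> uk kij; have wk : w 0 k = 1 by rewrite wE uk !add0r -natrD kij.
  have w012 a : [\/ w 0 a = 0, w 0 a = 1 | w 0 a = 2].
    rewrite wE; case: (eqVneq a i) => [->|_].
      by rewrite ui (negbTE ij); apply: Or32; rewrite /=; ring.
    case: (eqVneq a j) => [->|_]; first by rewrite uj; apply: Or32; rewrite /=; ring.
    by case: (u01 a) => ->; [apply: Or31|apply: Or33]; rewrite /=; ring.
  case kE: (rho k) => [|[|m]] //.
    have [[b bE] [c cE]] := (gapless_ex (m := 1) erefl, gapless_ex (m := 2) erefl).
    have := lt b c; rewrite cE bE => /(_ erefl) bc.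
    have := lt k b; rewrite kE bE wk => /(_ erefl) kb.
    by case: (no3 _ _ (w012 c) (w012 b) kb bc).
  have [b bE] := @gl k m.+1 ltac:(by rewrite kE).
  have [c cE] := @gl b m ltac:(by rewrite bE).
  have := lt b k; rewrite kE bE wk => /(_ erefl) bk.
  have := lt c b; rewrite cE bE => /(_ erefl) cb.
  by case: (no3' _ _ (w012 c) (w012 b) bk cb).
have ri : rho i = 1 by apply: w1; rewrite // eqxx (negbTE ij).
have rj : rho j = 1 by apply: w1; rewrite // eqxx eq_sym (negbTE ij).
have [[x rx] [c rc]] := (gapless_ex (m := 2) erefl, gapless_ex (m := 0) erefl).
have neq a b : rho a != rho b -> (a == b) = false.
  by move=> ab; apply/negbTE; apply: contra ab => /eqP ->.
have xc : (x == c) = false by rewrite neq // rx rc.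
have xi : (x == i) = false by rewrite neq // rx ri.
have xj : (x == j) = false by rewrite neq // rx rj.
have ci : (c == i) = false by rewrite neq // rc ri.
have cj : (c == j) = false by rewrite neq // rc rj.
have ux : u 0 x = 1.
  have := lt i x; rewrite ri rx => /(_ erefl); rewrite !wE xi xj ui eqxx (negbTE ij) /=.
  by case: (u01 x) => ->; lra.
have uc : u 0 c = 0.
  have := lt c i; rewrite ri rc => /(_ erefl); rewrite !wE ci cj ui eqxx (negbTE ij) /=.
  by case: (u01 c) => ->; lra.
pose V (bx bc bi bj : bool) : 'rV[R]_n := \row_k
  (if k == x then bx%:R else if k == c then bc%:R else
   if k == i then bi%:R else if k == j then bj%:R else u 0 k).
have V01 bx bc bi bj : is01 (V bx bc bi bj).
  have b01 (b : bool) : b%:R = 0 :> R \/ b%:R = 1 :> R by case: b; [right|left].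
  by move=> k; rewrite mxE; do 4![case: ifP => _; first exact: b01]; exact: u01.
have Vx bx bc bi bj : V bx bc bi bj 0 x = bx%:R by rewrite mxE eqxx.
have Vc bx bc bi bj : V bx bc bi bj 0 c = bc%:R by rewrite mxE eqxx eq_sym xc.
have Vi bx bc bi bj : V bx bc bi bj 0 i = bi%:R.
  by rewrite mxE eqxx ![i == _]eq_sym xi ci.
have Vj bx bc bi bj : V bx bc bi bj 0 j = bj%:R.
  by rewrite mxE eqxx ![j == _]eq_sym xj cj (negbTE ij).
have addx bc bi bj : V false bc bi bj + evec R x = V true bc bi bj.
  apply/rowP => k; rewrite [LHS]mxE evecE !mxE.
  by case: (eqVneq k x) => _; rewrite /= ?add0r ?addr0.
have addc bx bi bj : V bx false bi bj + evec R c = V bx true bi bj.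
  apply/rowP => k; rewrite [LHS]mxE evecE !mxE.
  case: (eqVneq k c) => [->|_]; last by rewrite addr0.
  by rewrite eq_sym xc add0r.
have addi bx bc bj : V bx bc false bj + evec R i = V bx bc true bj.
  apply/rowP => k; rewrite [LHS]mxE evecE !mxE.
  case: (eqVneq k i) => [->|_]; last by rewrite addr0.
  by rewrite ![i == _]eq_sym xi ci add0r.
have addj bx bc bi : V bx bc bi false + evec R j = V bx bc bi true.
  apply/rowP => k; rewrite [LHS]mxE evecE !mxE.
  case: (eqVneq k j) => [->|_]; last by rewrite addr0.
  by rewrite ![j == _]eq_sym xj cj (negbTE ij) add0r.
have uV : u = V true false false false.
  apply/rowP => k; rewrite mxE.
  case: eqP => [->//|_]; case: eqP => [->//|_]; case: eqP => [->//|_].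
  by case: eqP => [->|].
have ixE : (i, x) \in E by rewrite inE /= ri rx.
have ciE : (c, i) \in E by rewrite inE /= ri rc.
have xcE : (x, c) \notin E by rewrite inE /= rx rc.
have cxE : (c, x) \notin E by rewrite inE /= rx rc.
have Dij bx bc : bx ==> bc ->
    f (V bx bc true false) + f (V bx bc false true) =
    f (V bx bc true true) + f (V bx bc false false).
  move=> b; have := @tame_exchange_edge f (V bx bc false false) i j
    (if bx then (c, i) else (i, x)) tf (V01 _ _ _ _) ij ijE jiE (Vi _ _ _ _) (Vj _ _ _ _).
  rewrite gapD !addi !addj; apply; first by case: (bx).
  by case: bx bc b => [] [] //= _; rewrite /gap /= ?Vi ?Vx ?Vc /=; lra.
have Dxc bi bj : f (V true false bi bj) + f (V false true bi bj) =
    f (V true true bi bj) + f (V false false bi bj).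
  have := @tame_exchange_edge f (V false false bi bj) x c
    (if bi then (i, x) else (c, i)) tf (V01 _ _ _ _) (negbT xc) xcE cxE
    (Vx _ _ _ _) (Vc _ _ _ _).
  rewrite gapD !addx !addc; apply; first by case: (bi).
  by case: bi => //=; rewrite /gap /= ?Vi ?Vx ?Vc /=; lra.
rewrite uV !addi !addj.
have := (Dij false false erefl, Dij false true erefl, Dij true true erefl).
have := (Dxc false false, Dxc false true, Dxc true false, Dxc true true).
by move=> [[[? ?] ?] ?] [[? ?] ?]; lra.
Qed.

Lemma indic_vecD1 (T : {set 'I_n}) i : i \in T ->
  indic_vec R T = indic_vec R (T :\ i) + evec R i.
Proof. by move=> iT; rewrite /indic_vec (big_setD1 i) //= addrC. Qed.

(** Among three indices two have levels of the same parity and are not joined by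
    an edge, so second differences reduce to sets of at most two elements. *)
Lemma tame_indic0 f : tame f -> (forall i, f (evec R i) = 0) ->
  (forall p, p \in E -> f (evec R p.1 + evec R p.2) = 0) ->
  forall T : {set 'I_n}, f (indic_vec R T) = 0.
Proof.
move=> tf f1 f2 T; have [k] := ubnP #|T|; elim: k T => // k IH T /ltnSE Tk.
have exch i j : i \in T -> j \in T -> i != j -> (i, j) \notin E -> (j, i) \notin E ->
    f (indic_vec R T) = 0.
  move=> iT jT ij ijE jiE; pose U := T :\ i :\ j.
  have jTi : j \in T :\ i by rewrite !inE eq_sym ij.
  have U01 : is01 (indic_vec R U).
    by move=> m; rewrite indic_vecE; case: (m \in U); [right|left].
  have UT : (#|U|.+2 = #|T|)%N.
    by rewrite (cardsD1 i T) iT (cardsD1 j (T :\ i)) jTi.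
  have := tame_exchange tf U01 ij ijE jiE.
  rewrite !indic_vecE !inE !eqxx andbF => /(_ erefl erefl).
  have -> : indic_vec R U + evec R j = indic_vec R (T :\ i) by rewrite -indic_vecD1.
  have -> : indic_vec R U + evec R i + evec R j = indic_vec R T.
    by rewrite addrAC -indic_vecD1 // -indic_vecD1.
  have -> : indic_vec R U + evec R i = indic_vec R (i |: U).
    by rewrite [RHS](@indic_vecD1 _ i) ?setU1K ?inE ?eqxx // andbF.
  have UA : i \notin U by rewrite !inE eqxx andbF.
  rewrite (IH (i |: U)) ?(IH (T :\ i)) ?(IH U) ?addr0 //.
  - by apply: leq_trans Tk; rewrite -UT.
  - by apply: leq_trans Tk; rewrite [X in (_ <= X)%N](cardsD1 i T) iT.
  - by apply: leq_trans Tk; rewrite -UT cardsU1 UA.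
have [/card_gt2P[a [b [c [[aT bT cT] [ab bc ca]]]]]|] := boolP (2 < #|T|)%N.
  have par i j : odd (rho i) = odd (rho j) -> (i, j) \notin E.
    by move=> p; rewrite inE /=; apply/eqP => q; move: p; rewrite q /=; case: (odd _).
  have [p1|p1] := eqVneq (odd (rho a)) (odd (rho b)); first by apply: (exch a b); rewrite ?par.
  have [p2|p2] := eqVneq (odd (rho b)) (odd (rho c)); first by apply: (exch b c); rewrite ?par.
  have p3 : odd (rho c) = odd (rho a).
    by case: (odd (rho a)) (odd (rho b)) (odd (rho c)) p1 p2 => [] [] [].
  by apply: (exch c a); rewrite ?par.
rewrite -leqNgt => T2; have [->|/set0Pn[i iT]] := eqVneq T finset.set0.
  by rewrite /indic_vec big_set0 tame0.
have [Ti|/set0Pn[j]] := eqVneq (T :\ i) finset.set0.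
  by rewrite (indic_vecD1 iT) Ti /indic_vec big_set0 add0r.
rewrite !inE => /andP[ji jT].
have TE : indic_vec R T = evec R i + evec R j.
  rewrite (indic_vecD1 iT) (@indic_vecD1 _ j) ?inE ?ji // addrC; congr (_ + _).
  suff -> : T :\ i :\ j = finset.set0 by rewrite /indic_vec big_set0 add0r.
  apply/eqP; rewrite -cards_eq0 -leqn0 -2!ltnS; apply: leq_trans T2.
  by rewrite (cardsD1 i T) iT (cardsD1 j (T :\ i)) !inE ji jT.
have [ijE|ijE] := boolP ((i, j) \in E); first by rewrite TE (f2 _ ijE).
have [jiE|jiE] := boolP ((j, i) \in E); first by rewrite TE addrC (f2 _ jiE).
by apply: (exch i j); rewrite // eq_sym.
Qed.

(** Outside the cone where all slopes are positive, a vector splits into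
    compatible indicator vectors of superlevel sets. *)
Lemma tame_gap0 f : tame f -> (forall T : {set 'I_n}, f (indic_vec R T) = 0) ->
  forall v p, p \in E -> gap v p <= 0 -> f v = 0.
Proof.
move=> tf fT; have fZ := tf.1.
have pos (a : 'I_n -> R) : (forall i, 0 <= a i) ->
    forall p, p \in E -> gap (\row_i a i) p <= 0 -> f (\row_i a i) = 0.
  move: a; apply: layer_ind => [p _ _|a T m a0 m0 aT _ IH p pE].
    by rewrite (_ : \row__ _ = 0) ?tame0 //; apply/rowP => i; rewrite !mxE.
  have -> : \row_i (a i + m * (i \in T)%:R) = \row_i a i + m *: indic_vec R T.
    by apply/rowP => i; rewrite [RHS]mxE [X in _ = _ + X]mxE indic_vecE !mxE.
  have comp : compatible (\row_i a i) (m *: indic_vec R T).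
    move=> q _; rewrite gapZ mulrCA pmulr_rge0 // /gap !indic_vecE !mxE.
    have out i : i \notin T -> a i = 0 by move=> iT; apply: contraNeq iT => /aT.
    have [T2|/out a2] := boolP (q.2 \in T); have [T1|/out a1] := boolP (q.1 \in T);
      rewrite /= ?subrr ?mulr0 // ?a1 ?a2 ?subr0 ?mulr1 //.
    by rewrite !sub0r mulrN1 opprK.
  move=> le0; rewrite (tame_add tf comp pE le0) fZ ?ltW // fT mulr0 addr0.
  by apply: (IH p pE); case: (compatible_le0 comp pE le0).
move=> v p pE vp; pose t := \sum_i `|v 0 i|; pose e := indic_vec R (finset.setT : {set 'I_n}).
have compe w (s : R) : compatible w (s *: e).
  by move=> q _; rewrite gapZ gap_all_ones !mulr0.
have t0 : 0 <= t by apply: sumr_ge0.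
have te : f (t *: e) = 0 by rewrite fZ // fT mulr0.
have nte : f (- t *: e) = 0.
  have := @tame_add f (t *: e) (- t *: e) p tf (compe _ _) pE.
  rewrite -scalerDl subrr scale0r te add0r tame0 // => <- //.
  by rewrite /gap !mxE subrr.
have -> : v = (v + t *: e) + (- t) *: e by rewrite scaleNr addrK.
have gE (s : R) w : gap (w + s *: e) p = gap w p.
  by rewrite gapD gapZ gap_all_ones mulr0 addr0.
rewrite (tame_add tf (compe _ _) pE) ?gE // nte addr0.
have -> : v + t *: e = \row_i (v 0 i + t).
  by apply/rowP => i; rewrite !mxE -/e indic_vecE inE mulr1.
apply: (pos _ _ p pE) => [i|]; last first.
  by move: vp; rewrite /gap !mxE; lra.
rewrite -lerBlDl sub0r (le_trans _ (_ : `|v 0 i| <= t)) //; first by rewrite -normrN ler_norm.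
by rewrite /t (bigD1 i) //= lerDl sumr_ge0.
Qed.

Lemma gap_level_edge p : p \in E -> gap (level_vec rho : 'rV[R]_n) p = 1.
Proof. by rewrite inE gap_level_vec => /eqP ->; rewrite -natrB // subSnn. Qed.

(** Inside that cone, subtract the multiple of [level_vec rho] that brings the
    least slope to 0. *)
Lemma tame_min_gap f : tame f -> (forall T : {set 'I_n}, f (indic_vec R T) = 0) ->
  forall v, f v = f (level_vec rho) * g v.
Proof.
move=> tf fT v; have [p pE [gE pmin]] := min_gapP v E0.
have [vp|vp] := leP (gap v p) 0.
  by rewrite (tame_gap0 tf fT pE vp) /g (min_gap_eq0 pE vp) mulr0.
have gv : g v = gap v p by rewrite /g gE; apply/max_idPr/ltW.
set m := gap v p in vp gv pmin.
pose u := m *: level_vec rho; pose w := v - u.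
have gapu q : q \in E -> gap u q = m by move=> qE; rewrite gapZ gap_level_edge // mulr1.
have gapw q : q \in E -> gap w q = gap v q - m.
  by move=> qE; rewrite -(gapu q qE) /gap !mxE; ring.
have wp : gap w p <= 0 by rewrite gapw // subrr.
have vE : v = u + w by rewrite /w addrC subrK.
rewrite gv [in LHS]vE (tf.2 u w).
- by rewrite (tame_gap0 tf fT pE wp) addr0 tf.1 ?ltW // mulrC.
- by move=> q qE; rewrite gapu // gapw // mulr_ge0 ?(ltW vp) ?subr_ge0 ?pmin.
rewrite -vE gv /g (min_gap_eq0 pE wp) addr0 (min_gap_eq pE) gapu //.
  by apply/esym/max_idPr/ltW.
by move=> q qE; rewrite gapu.
Qed.

(** A vector of slope -1 along [p] and of nonnegative slope along every other
    edge. *)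
Definition tilt (p : 'I_n * 'I_n) : 'rV[R]_n := \row_j
  (if rho j == rho p.1 then (j == p.1)%:R
   else if rho j == rho p.2 then (j != p.2)%:R else (rho p.2 < rho j)%N%:R).

Lemma gap_tilt p q : p \in E -> q \in E ->
  if q == p then gap (tilt p) q = -1 else 0 <= gap (tilt p) q.
Proof.
case: p q => [a b] [c d]; rewrite /gap !inE /= => /eqP ab /eqP cd; rewrite !mxE /= xpair_eqE.
have [ca|ca] := eqVneq (rho c) (rho a).
  rewrite cd ca -ab eqxx gtn_eqF //=; last by rewrite ab.
  by case: (c == a); case: (d == b) => //=; lra.
have -> : (c == a) = false by apply: contraNF ca => /eqP ->.
have [cb|cb] := eqVneq (rho c) (rho b).
  rewrite cd cb ab eqn_leq ltnNge (ltnW (ltnSn _)) /=.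
  rewrite gtn_eqF //= ltnSn; case: (c != b) => /=; lra.
rewrite cd; have [da|da] := eqVneq (rho c).+1 (rho a).
  by rewrite ltnNge ab -da ltnW //= subr0 ler0n.
have -> : ((rho c).+1 == rho b) = false by rewrite ab eqSS; apply: negbTE.
rewrite subr_ge0 ler_nat; have [H|//] := boolP (rho b < rho c)%N.
by rewrite leqW.
Qed.

Lemma min0_le0 (x : R) : x <= 0 -> Num.min 0 x = x.
Proof. by move=> ?; apply/min_idPr. Qed.

Lemma min0_ge0 (x : R) : 0 <= x -> Num.min 0 x = 0.
Proof. by move=> ?; apply/min_idPl. Qed.

(** After subtracting a linear form and multiples of [min(v_a, v_b)], what is left
    of [f] is a multiple of [min_gap]; additivity at [tilt p] and [level_vec rho]
    then makes the coefficient of each edge [p] equal to that multiple. *)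
Lemma indecomposable_trunc_zonotope : indecomposable (trunc_zonotope (R := R) E).
Proof.
apply: indecomposable_support; first exact: polytope_trunc_zonotope.
move=> f fZ fD.
have hE v : support_fun (trunc_zonotope E) v = \sum_(p in E) Num.min 0 (gap v p) + g v.
  exact: support_trunc_zonotope.
pose tau (p : 'I_n * 'I_n) := f (evec R p.1 + evec R p.2) - f (evec R p.1) - f (evec R p.2).
pose l v := \sum_i v 0 i * f (evec R i) + \sum_(p in E) v 0 p.1 * tau p.
pose k v := \sum_(p in E) Num.min 0 (gap v p) * tau p.
have lD u w : l (u + w) = l u + l w.
  rewrite /l addrACA -!big_split /=; congr (_ + _); apply: eq_bigr => i _;
  by rewrite mxE mulrDl.
have lZ (t : R) u : l (t *: u) = t * l u.
  by rewrite /l mulrDr !mulr_sumr; congr (_ + _); apply: eq_bigr => i _; rewrite mxE mulrA.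
pose f' v := f v - l v - k v.
have tf' : tame f'.
  split=> [t u t0|u w cuw guw].
    rewrite /f' fZ // lZ !mulrBr; congr (_ - _); rewrite /k mulr_sumr.
    apply: eq_bigr => p _; rewrite gapZ mulrA; congr (_ * _).
    by rewrite -[in LHS](mulr0 t) minr_pMr.
  have mD p : p \in E -> Num.min 0 (gap (u + w) p) = Num.min 0 (gap u p) + Num.min 0 (gap w p).
    by move=> pE; rewrite gapD min0D // cuw.
  have kD : k (u + w) = k u + k w.
    by rewrite /k -big_split; apply: eq_bigr => p pE; rewrite mD // mulrDl.
  rewrite /f' lD kD fD; first ring.
  by rewrite !hE guw (eq_bigr _ mD) big_split /=; ring.
have sum1 (G : 'I_n -> R) i : \sum_j evec R i 0 j * G j = G i.
  rewrite (bigD1 i) //= evecE eqxx mul1r big1 ?addr0 // => j /negbTE ji.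
  by rewrite evecE ji mul0r.
have f'1 i : f' (evec R i) = 0.
  rewrite /f' /l /k sum1 opprD addrA subrr sub0r -opprD -big_split /= big1 ?oppr0 // => p pE.
  rewrite -mulrDl /gap !evecE; have := edge_neq pE.
  case: (eqVneq p.1 i) => [p1|_]; case: (eqVneq p.2 i) => [p2|_];
    rewrite ?p1 ?p2 ?eqxx //= => _; first by rewrite min0_le0; lra.
    by rewrite min0_ge0; lra.
  by rewrite min0_ge0; lra.
have f'2 p : p \in E -> f' (evec R p.1 + evec R p.2) = 0.
  move=> pE; have pp := edge_neq pE.
  set v := _ + _; have -> : f' v = f v - f (evec R p.1) - f (evec R p.2) -
      \sum_(q in E) (v 0 q.1 + Num.min 0 (gap v q)) * tau q.
    rewrite /f' /l /k; under [in RHS]eq_bigr do rewrite mulrDl.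
    have -> : \sum_i v 0 i * f (evec R i) = f (evec R p.1) + f (evec R p.2).
      by under eq_bigr do rewrite /v mxE mulrDl; rewrite big_split /= !sum1.
    by rewrite big_split /=; ring.
  rewrite (bigD1 p) //= big1 ?addr0 => [|q /andP[qE qp]].
    rewrite /gap !mxE !eqxx (negbTE pp) eq_sym (negbTE pp) /= min0_ge0; last lra.
    by rewrite /tau -/v; ring.
  rewrite /gap !mxE !eqxx /= -[RHS](mul0r (tau q)); congr (_ * _).
  have qq := edge_neq qE; move: qp; rewrite -pair_eqE /pair_eq.
  have := qE; have := pE; rewrite !inE => /eqP rp /eqP rq.
  case: (eqVneq q.1 p.1) => [q1|_]; case: (eqVneq q.2 p.2) => [q2|_] //= _.
  - have -> : (q.1 == p.2) = false by rewrite q1 (negbTE pp).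
    have -> : (q.2 == p.1) = false by rewrite -q1 eq_sym (negbTE qq).
    by rewrite min0_le0 /=; lra.
  - have -> : (q.1 == p.2) = false by rewrite -q2 (negbTE qq).
    have -> : (q.2 == p.1) = false by rewrite q2 eq_sym (negbTE pp).
    by rewrite min0_ge0 /=; lra.
  - case: (eqVneq q.1 p.2) => [q1|_]; case: (eqVneq q.2 p.1) => [q2|_] /=.
    + by move: rq; rewrite q1 q2 rp => /eqP; rewrite ltn_eqF // ltnW.
    + by rewrite min0_le0; lra.
    + by rewrite min0_ge0; lra.
    + by rewrite min0_ge0; lra.
have fT := tame_indic0 tf' f'1 f'2.
have f'E := tame_min_gap tf' fT.
set s := f' (level_vec rho) in f'E.
have fE v : f v = l v + k v + s * g v by rewrite -f'E /f'; ring.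
have tauE p : p \in E -> tau p = s.
  move=> pE; set u := tilt p; set w := level_vec rho in s f'E fE *.
  have wq q : q \in E -> gap w q = 1 by exact: gap_level_edge.
  have uq q : q \in E -> Num.min 0 (gap u q) = - (q == p)%:R.
    move=> /(gap_tilt pE); case: eqP => [_ ->|_ /min0_ge0 ->]; last by rewrite oppr0.
    by rewrite min0_le0 /=; lra.
  have up : gap u p = -1 by have := gap_tilt pE pE; rewrite eqxx.
  have uwq q : q \in E -> Num.min 0 (gap (u + w) q) = 0.
    move=> qE; rewrite gapD wq // min0_ge0 //.
    by have := gap_tilt pE qE; rewrite -/u; case: ifP => _; lra.
  have gu : g u = 0 by rewrite /g (min_gap_eq0 pE) // up; lra.
  have guw : g (u + w) = 0 by rewrite /g (min_gap_eq0 pE) // gapD up wq //; lra.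
  have gw : g w = 1.
    rewrite /g (min_gap_eq pE) => [|q qE]; rewrite !wq //.
    by apply/max_idPr/ler01.
  have w0 q : q \in E -> Num.min 0 (gap w q) = 0 by move=> qE; rewrite wq // min0_ge0.
  have sumu (G : 'I_n * 'I_n -> R) : \sum_(q in E) Num.min 0 (gap u q) * G q = - G p.
    rewrite (bigD1 p) //= uq // eqxx mulN1r big1 ?addr0 // => q /andP[qE /negbTE qp].
    by rewrite uq // qp oppr0 mul0r.
  have sum0 v : (forall q, q \in E -> Num.min 0 (gap v q) = 0) ->
      \sum_(q in E) Num.min 0 (gap v q) = 0 /\ k v = 0.
    move=> v0; split; first by rewrite big1.
    by rewrite /k big1 // => q qE; rewrite v0 // mul0r.
  have [[sw kw] [suw kuw]] := (sum0 w w0, sum0 (u + w) uwq).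
  have su : \sum_(q in E) Num.min 0 (gap u q) = -1.
    by rewrite -(sumu (fun=> 1)); apply: eq_bigr => q _; rewrite mulr1.
  have := fD u w; rewrite !hE gu gw guw sw suw su => /(_ ltac:(by ring)).
  by rewrite !fE gu gw guw lD kw kuw [k u]sumu; lra.
exists s, (\row_j f (evec R j) + \sum_(p in E) s *: evec R p.1) => u.
rewrite fE hE mulrDr addrA; congr (_ + _ + _).
  rewrite dotDr dot_sumr /l; congr (_ + _); first by apply: eq_bigr => i _; rewrite mxE.
  by apply: eq_bigr => p pE; rewrite dotZr dot_evec tauE // mulrC.
by rewrite /k mulr_sumr; apply: eq_bigr => p pE; rewrite tauE // mulrC.
Qed.

End IndecTruncated.

(** * The basis theorem *)

Section FinalBasis.
Context {R : realType} {n : nat}.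

Lemma apex_truncation_basis_polytope (S : seq {set 'I_n}) :
  ordered_set_partition S -> (3 <= size S)%N ->
  exists2 s : label n, valid_label s & apex_truncation R S = basis_polytope s.
Proof.
move=> oS S3; exists (inr [ffun j => Ordinal (gapless_lt j (lev_gapless oS))]).
  have rE : label_levels [ffun j => Ordinal (gapless_lt j (lev_gapless oS))] = lev S.
    by apply/funext => i; rewrite /label_levels ffunE.
  rewrite /= rE; apply/andP; split; first exact/asboolP/lev_gapless.
  by have [j jE] := lev_surj oS S3; apply/existsP; exists j; rewrite jE.
rewrite apex_truncationE //=; congr (trunc_zonotope (edges _)).
by apply/funext => i; rewrite /label_levels ffunE.
Qed.

(** The members of the basis, indexed by the valid labels. *)
Lemma basis_polytopes :
  [set apex_truncation R S | S in
     [set S : seq {set 'I_n} | ordered_set_partition S /\ (3 <= size S)%N]]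
  `|` [set simplex R I | I in [set I : {set 'I_n} | I != finset.set0]] =
  [set basis_polytope (R := R) s | s in [set s | valid_label s]].
Proof.
apply/seteqP; split=> [_ [[S [oS S3] <-]|[I I0 <-]]|_ [[I|rho] vs <-]].
- by have [s vs ->] := apex_truncation_basis_polytope oS S3; exists s.
- by exists (inl I).
- by right; exists I.
have [gl r2] := valid_label_levels vs.
have [S [oS S3 levS]] := osp_of_levels gl r2.
by left; exists S => //; rewrite apex_truncationE // levS.
Qed.

Lemma indecomposable_basis_polytope (s : label n) : valid_label s ->
  indecomposable (basis_polytope (R := R) s).
Proof.
case: s => [I|rho] vs; first exact: indecomposable_simplex.
by have [gl r2] := valid_label_levels vs; exact: indecomposable_trunc_zonotope.
Qed.

End FinalBasis.

Theorem theorem1p5 (R : realType) (n : nat) (hn : (1 <= n)%N) :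
  indecomposable_polytopal_basis (braid2_fan R n)
    ([set apex_truncation R S | S in
        [set S : seq {set 'I_n} | ordered_set_partition S /\ (3 <= size S)%N]]
     `|` [set simplex R I | I in [set I : {set 'I_n} | I != finset.set0]]).
Proof.
rewrite basis_polytopes; split; last by move=> _ [s vs <-]; exact: indecomposable_basis_polytope.
split.
  move=> _ [s vs <-]; split; first exact: polytope_basis_polytope.
  apply: chain_additive_coarsens; first exact: polytope_basis_polytope.
  exact: basis_polytope_chain_additive.
split.
- move=> _ [s vs <-].
  apply: chain_additive_PL; first exact: polytope_basis_polytope.
  exact: basis_polytope_chain_additive.
- move=> k p c p_inj pE sum0.
  have /choice[lab labP] : forall i, exists s, valid_label s /\ basis_polytope s = p i.
    by move=> i; have [s vs sE] := pE i; exists s.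
  have lab_inj : injective lab.
    by move=> i j ij; apply: p_inj; rewrite -(labP i).2 -(labP j).2 ij.
  (* the coefficients transported to labels *)
  pose d s := \sum_(i | lab i == s) c i.
  have d0 : forall s, valid_label s -> d s = 0.
    apply: (basis_polytope_indep (R := R)) => v; rewrite -[RHS](sum0 v).
    under eq_bigr do rewrite mulr_suml.
    rewrite (exchange_big_dep xpredT) //=; apply: eq_bigr => i _.
    rewrite (big_pred1 (lab i)) => [|s]; first by rewrite (labP i).2.
    by rewrite /= [RHS]eq_sym; case: eqP => [<-|_]; rewrite ?(labP i).1 ?andbF.
  move=> i; have := d0 _ (labP i).1; rewrite /d (big_pred1 i) // => j.
  by apply/eqP/eqP => [/lab_inj|->].
- move=> g /PL_chain_additive/basis_polytope_span[c gE].
  pose V := [set s : label n | valid_label s]%SET.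
  exists #|V|, (fun i => basis_polytope (R := R) (enum_val (A := V) i)),
    (fun i => c (enum_val i)); split.
    by move=> i; exists (enum_val i) => //; have := enum_valP i; rewrite inE.
  move=> v; rewrite gE -(big_enum_val (fun s => c s * support_fun (basis_polytope s) v)).
  by apply: eq_bigl => s; rewrite inE.
Qed.
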